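(* Let $Y$ be a simplicial complex, and let $G$ be a group acting on $Y$ by simplicial automorphisms. Let $I$ be a set equipped with a left $G$-action, and let $\mathcal V=\{\Sigma_i\}_{i\in I}$ be a covering of $Y$ by subcomplexes, with the following properties: - $g\Sigma_i=\Sigma_{gi}$ for all $g\in G$ and $i\in I$; - for any finite $F\subset I$, the intersection $\bigcap_{i\in F}\Sigma_i$ is either empty or contractible. Let $\mathcal N$ be the nerve of the covering $\mathcal V$. Then there is a $G\!\sim$ homotopy equivalence $f\colon Y\to(\mathcal N,\mathcal T_w)$.
   Context: If a group $G$ acts by homeomorphisms on spaces $A,B$, a map $f\colon A\to B$ is a $G\!\sim$ homotopy equivalence if it is a homotopy equivalence and, for every $g\in G$, the maps $g\circ f$ and $f\circ g$ are homotopic. Simplicial complexes (possibly locally infinite) carry the weak topology $\mathcal T_w$: a set is closed iff its intersection with each closed simplex is closed. In particular $Y$ has the weak topology. The nerve $\mathcal N$ of a covering $\{\Sigma_i\}_{i\in I}$ is the simplicial complex whose simplices correspond to the nonempty finite subsets $F\subset I$ with $\bigcap_{i\in F}\Sigma_i\neq\emptyset$: it has a vertex $v_i$ for each (nonempty) $\Sigma_i$, and $v_{i_0},\dots,v_{i_n}$ span an $n$-simplex whenever $\bigcap_{j}\Sigma_{i_j}\ne\emptyset$. The group $G$ acts on $\mathcal N$ by simplicial automorphisms via its action on $I$. Finite subsets $F$ in the hypothesis are nonempty. *)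

(* Defs.v *)
From HB Require Import structures.
From mathcomp Require Import all_boot all_order all_algebra finmap.
From mathcomp Require Import boolp classical_sets functions set_interval reals.
From mathcomp Require Import topology normedtype.

Set Implicit Arguments.
Unset Strict Implicit.
Unset Printing Implicit Defensive.

Import Order.TTheory GRing.Theory Num.Theory.
Import numFieldNormedType.Exports.

Local Open Scope classical_set_scope.
Local Open Scope ring_scope.

Record left_action (G : groupType) (T : Type) := LeftAction {
  act_fun :> G -> T -> T;
  act1 : forall x, act_fun 1%g x = x;
  actM : forall g h x, act_fun (g * h)%g x = act_fun g (act_fun h x) }.

Lemma actK (G : groupType) (T : Type) (a : left_action G T) (g : G) :
  cancel (a g) (a g^-1%g).
Proof. by move=> x; rewrite -actM mulVg act1. Qed.

Lemma actVK (G : groupType) (T : Type) (a : left_action G T) (g : G) :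
  cancel (a g^-1%g) (a g).
Proof. by move=> x; rewrite -actM mulgV act1. Qed.

(* Each [a g] is then a homeomorphism, with inverse [a g^-1]. *)
Record top_action (G : groupType) (X : topologicalType) := TopAction {
  top_act :> left_action G X;
  top_act_continuous : forall g, continuous (top_act g) }.

Section Homotopy.
Variable R : realType.

Definition homotopic (X Y : topologicalType) (f g : X -> Y) : Prop :=
  exists H : R * X -> Y,
    [/\ {within `[0, 1] `*` [set: X], continuous H},
        forall x, H (0, x) = f x & forall x, H (1, x) = g x].

Definition homotopy_equivalence (X Y : topologicalType) (f : X -> Y) : Prop :=
  continuous f /\
  exists h : Y -> X,
    [/\ continuous h, homotopic (h \o f) id & homotopic (f \o h) id].

Definition contractible (X : topologicalType) : Prop :=
  exists x0 : X, homotopic id (fun _ : X => x0).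

Definition Gsim_homotopy_equivalence (G : groupType) (A B : topologicalType)
    (aA : top_action G A) (aB : top_action G B) (f : A -> B) : Prop :=
  homotopy_equivalence f /\ forall g : G, homotopic (aB g \o f) (f \o aA g).

End Homotopy.

(* The vertices of [K] are the [v : V] with [simplices K [fset v]%fset]; an element of  *)
(* [V] need not be a vertex, so that subcomplexes live on the same type [V].  *)
Record scomplex (V : choiceType) := SComplex {
  simplices :> set {fset V};
  simplex_neq0 : forall F, simplices F -> F != fset0;
  simplex_face : forall F E : {fset V},
    simplices F -> (E `<=` F)%fset -> E != fset0 -> simplices E }.

(* Points of the geometric realization |K| are given by their barycentric     *)
(* coordinates.                                                               *)
Section Realization.
Variables (R : realType) (V : choiceType) (K : scomplex V).

Definition barycentric (x : {fsfun V -> R with 0}) : bool :=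
  [&& `[< simplices K (finsupp x) >], `[< forall v, 0 <= x v >] &
      \sum_(v <- finsupp x) x v == 1].

Record realization := Realization {
  coord :> {fsfun V -> R with 0};
  coordP : barycentric coord }.

HB.instance Definition _ := [isSub for coord].
HB.instance Definition _ := [Choice of realization by <:].

Definition closed_simplex (F : {fset V}) : set realization :=
  [set x | (finsupp x `<=` F)%fset].

(* [F] being finite, pointwise convergence of the coordinates induces the     *)
(* Euclidean topology on [closed_simplex F].                                  *)
Definition closed_in_simplex (F : {fset V}) (A : set realization) : Prop :=
  exists2 C : set {ptws V -> R}, closed C &
    A `&` closed_simplex F =
    [set x : realization | C (x : V -> R)] `&` closed_simplex F.

Definition weak_closed (A : set realization) : Prop :=
  forall F, simplices K F -> closed_in_simplex F A.

Definition weak_open (A : set realization) : Prop := weak_closed (~` A).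

Lemma weak_openT : weak_open setT.
Proof.
move=> F _; exists set0; first exact: closed0.
by rewrite setCT; apply/seteqP; split=> x [].
Qed.

Lemma weak_openI (A B : set realization) :
  weak_open A -> weak_open B -> weak_open (A `&` B).
Proof.
move=> oA oB F KF; have [C cC AC] := oA F KF; have [D cD BD] := oB F KF.
exists (C `|` D); first exact: closedU.
by rewrite setCI setIUl AC BD -setIUl.
Qed.

Lemma weak_open_bigU (J : Type) (A : J -> set realization) :
  (forall j, weak_open (A j)) -> weak_open (\bigcup_j A j).
Proof.
move=> oA F KF.
have /choice[C CP] : forall j, exists C : set {ptws V -> R}, closed C /\
    ~` A j `&` closed_simplex F =
    [set x : realization | C (x : V -> R)] `&` closed_simplex F.
  by move=> j; have [C cC AC] := oA j F KF; exists C.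
exists (\bigcap_j C j); first by apply: closed_bigI => j _; exact: (CP j).1.
rewrite setC_bigcup; apply/seteqP; split=> x [/= xA xF]; split=> // j _.
  by have /seteqP[/(_ x (conj (xA j I) xF))[]] := (CP j).2.
by have /seteqP[_ /(_ x (conj (xA j I) xF))[]] := (CP j).2.
Qed.

HB.instance Definition _ :=
  isOpenTopological.Build realization weak_openT weak_openI weak_open_bigU.

Lemma closed_realizationP (A : set realization) : closed A <-> weak_closed A.
Proof.
rewrite -openC; split=> [oA|cA].
- by rewrite -[A]setCK; exact: oA.
- by change (weak_open (~` A)); rewrite /weak_open setCK.
Qed.

End Realization.

Arguments realization R {V} K.

Section FsetAction.
Variables (G : groupType) (V : choiceType) (a : left_action G V).

Definition fset_act (g : G) (F : {fset V}) : {fset V} :=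
  [fset a g v | v in F]%fset.

Lemma fset_act1 F : fset_act 1%g F = F.
Proof.
apply/fsetP => v; apply/imfsetP/idP => /= [[w wF ->]|vF]; first by rewrite act1.
by exists v => //; rewrite act1.
Qed.

Lemma fset_actM g h F : fset_act (g * h)%g F = fset_act g (fset_act h F).
Proof.
apply/fsetP => v; apply/imfsetP/imfsetP => /= [[w wF ->]|[_ /imfsetP[w /= wF ->] ->]].
  by exists (a h w); [apply/imfsetP; exists w | rewrite actM].
by exists w => //; rewrite actM.
Qed.

Definition fset_action : left_action G {fset V} := LeftAction fset_act1 fset_actM.

Lemma mem_fset_act g F v : (v \in fset_act g F) = (a g^-1%g v \in F).
Proof.
apply/imfsetP/idP => /= [[w wF ->]|vF]; first by rewrite actK.
by exists (a g^-1%g v) => //; rewrite actVK.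
Qed.

End FsetAction.

(* Applied to [g] and [g^-1], [simplex_act] makes each [g] an automorphism.   *)
Record simplicial_action (G : groupType) (V : choiceType) (K : scomplex V) :=
  SimplicialAction {
    vertex_act :> left_action G V;
    simplex_act : forall (g : G) (F : {fset V}),
      simplices K F -> simplices K (fset_action vertex_act g F) }.

Definition precomp (V T : Type) (h : V -> V) (y : {ptws V -> T}) :
  {ptws V -> T} := y \o h.

Lemma precomp_continuous (V : choiceType) (T : topologicalType) (h : V -> V) :
  continuous (precomp h : {ptws V -> T} -> {ptws V -> T}).
Proof.
move=> y.
have FF : Filter (precomp h z @[z --> y]).
  by apply: fmap_filter; exact: (@nbhs_filter _ y).
apply/(@cvg_sup _ _ _ _ _ FF) => v U [_ [[W oW <-]] /= Wy WU].
have /(_ W) cp := @proj_continuous V (fun=> T) (h v) y.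
apply: (filterS WU); apply: cp.
exact: open_nbhs_nbhs.
Qed.

(* The action on |K| that permutes vertices and is affine on closed simplices *)
Section RealizationAction.
Variables (R : realType) (G : groupType) (V : choiceType) (K : scomplex V).
Variable a : simplicial_action G K.

Definition push (g : G) (x : {fsfun V -> R with 0}) : {fsfun V -> R with 0} :=
  [fsfun v in fset_act a g (finsupp x) => x (a g^-1%g v) | 0].

Lemma pushE g x v : push g x v = x (a g^-1%g v).
Proof.
by rewrite fsfunE mem_fset_act; case: finsuppP.
Qed.

Lemma finsupp_push g x : finsupp (push g x) = fset_act a g (finsupp x).
Proof. by apply/fsetP => v; rewrite mem_fset_act !mem_finsupp pushE. Qed.

Lemma push_barycentric g (x : realization R K) : barycentric K (push g x).
Proof.
have /and3P[/asboolP Kx /asboolP x0 x1] := coordP x.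
apply/and3P; split.
- by apply/asboolP; rewrite finsupp_push; exact: simplex_act.
- by apply/asboolP => v; rewrite pushE.
- rewrite finsupp_push /fset_act big_imfset/=; last first.
    by move=> u v _ _ /(can_inj (actK a g)).
  rewrite -(eqP x1); apply/eqP; apply: eq_bigr => v _.
  by rewrite pushE actK.
Qed.

Definition realization_act (g : G) (x : realization R K) : realization R K :=
  Realization (push_barycentric g x).

Lemma realization_act1 x : realization_act 1%g x = x.
Proof. by apply/val_inj/fsfunP => v; rewrite /= pushE -{1}(mulg1 1^-1)%g mulVg act1. Qed.

Lemma realization_actM g h x :
  realization_act (g * h)%g x = realization_act g (realization_act h x).
Proof. by apply/val_inj/fsfunP => v; rewrite /= !pushE invgM actM. Qed.

Lemma realization_act_continuous g : continuous (realization_act g).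
Proof.
apply/continuousP => A oA.
have {}oA : weak_open A by [].
change (weak_open (realization_act g @^-1` A)) => F KF.
have [C cC AC] := oA _ (simplex_act a g KF).
exists (precomp (a g^-1%g) @^-1` C).
  by apply: preimage_closed cC => y _; exact: precomp_continuous.
have simpE x : closed_simplex (fset_action a g F) (realization_act g x) <->
               closed_simplex F x.
  rewrite /closed_simplex /= finsupp_push; split=> /fsubsetP sF; apply/fsubsetP.
    move=> v vx; have := sF (a g v); rewrite !mem_fset_act actK; exact.
  by move=> v; rewrite !mem_fset_act; exact: sF.
have E (x : realization R K) :
    precomp (a g^-1%g) (x : V -> R) = (realization_act g x : V -> R).
  by apply/funext => v; rewrite /= pushE.
apply/seteqP; split=> x [xA xF]; split=> //.
- have /seteqP[/(_ (realization_act g x)) + _] := AC.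
  by move=> /(_ (conj xA (iffRL (simpE x) xF)))[+ _]; rewrite /= -E.
- have /seteqP[_ /(_ (realization_act g x))] := AC.
  move: xA; rewrite /= E => xA.
  by move=> /(_ (conj xA (iffRL (simpE x) xF)))[].
Qed.

Definition realization_action : top_action G (realization R K) :=
  TopAction (top_act := LeftAction realization_act1 realization_actM)
    realization_act_continuous.

End RealizationAction.

Arguments realization_action R {G V K} a.

(* [E != fset0] matters only for [F = fset0], where the intersection is full. *)
Section Intersection.
Variables (V I : choiceType) (S : I -> scomplex V) (F : {fset I}).

Definition inter_simplices : set {fset V} :=
  [set E | E != fset0 /\ (\bigcap_(i in [set` F]) S i) E].

Lemma inter_neq0 E : inter_simplices E -> E != fset0. Proof. by case. Qed.

Lemma inter_face (E E' : {fset V}) :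
  inter_simplices E -> (E' `<=` E)%fset -> E' != fset0 -> inter_simplices E'.
Proof.
move=> [_ SE] sE nE; split=> // i iF.
by apply: simplex_face sE nE; exact: SE.
Qed.

Definition inter_complex : scomplex V := SComplex inter_neq0 inter_face.

End Intersection.

Section Nerve.
Variables (T : Type) (I : choiceType) (A : I -> set T).

Definition nerve_simplices : set {fset I} :=
  [set F | F != fset0 /\ \bigcap_(i in [set` F]) A i !=set0].

Lemma nerve_neq0 F : nerve_simplices F -> F != fset0. Proof. by case. Qed.

Lemma nerve_face (F E : {fset I}) :
  nerve_simplices F -> (E `<=` F)%fset -> E != fset0 -> nerve_simplices E.
Proof.
move=> [_ [x xF]] /fsubsetP sE nE; split=> //.
by exists x => i /= /sE; exact: xF.
Qed.

Definition nerve : scomplex I := SComplex nerve_neq0 nerve_face.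

Variables (G : groupType) (aT : left_action G T) (aI : left_action G I).
Hypothesis aTA : forall g i, aT g @` A i = A (aI g i).

Lemma nerve_act_subproof g F : simplices nerve F -> simplices nerve (fset_action aI g F).
Proof.
move=> [/fset0Pn[i iF] [x xF]]; split.
  by apply/fset0Pn; exists (aI g i); apply/imfsetP; exists i.
exists (aT g x) => _ /imfsetP[j /= jF ->].
by rewrite -aTA; exists x => //; exact: xF.
Qed.

Definition nerve_action : simplicial_action G nerve :=
  SimplicialAction nerve_act_subproof.

End Nerve.

(* Main.v *)
Require Import Defs.
From HB Require Import structures.
From mathcomp Require Import all_boot all_order all_algebra finmap.
From mathcomp Require Import boolp classical_sets functions set_interval reals.
From mathcomp Require Import topology normedtype.
From mathcomp Require Import lra.

Set Implicit Arguments.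
Unset Strict Implicit.
Unset Printing Implicit Defensive.

Import Order.TTheory GRing.Theory Num.Theory.
Import numFieldNormedType.Exports.

Local Open Scope classical_set_scope.
Local Open Scope ring_scope.

(* All maps and homotopies are obtained from the principle of acyclic carriers:
   if every simplex F of K is assigned, monotonically, a contractible subcomplex
   Phi F of L, then there is a map |K| -> |L| carried by Phi, and any two such
   maps are homotopic.

   f : Y -> N is carried by F |-> { E | the Sigma_i, i in E, share a face of F },
   a cone with apex any i such that F is in Sigma_i. As this carrier is
   equivariant, g f and f g are carried by a common one, hence homotopic.
   In the other direction, a map h from the subdivision of N to Y is carried by
   c |-> the intersection of the Sigma_i, i in min c. On N, f h and the identity
   are both carried by the closed star of min c. On Y, f is first replaced by a
   simplicial map out of the second subdivision: choosing an index iota E with E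
   in Sigma_(iota E), it sends a chain c of simplices to { iota E | E in c }. Then
   h f and the map contracting a chain of chains S into the simplex
   min (min S) are both carried by the intersection of the Sigma_(iota E),
   E in min S. *)

(** * The weak topology *)

Section RealizationTopology.
Variables (R : realType) (V : choiceType) (K : scomplex V).
Implicit Types (x y z : realization R K) (F : {fset V}).

Lemma supp_simplex x : simplices K (finsupp x).
Proof. by have /and3P[/asboolP] := coordP x. Qed.

Lemma coord_ge0 x v : 0 <= x v.
Proof. by have /and3P[_ /asboolP] := coordP x. Qed.

Lemma coord_notin F x v : closed_simplex F x -> v \notin F -> x v = 0.
Proof.
move=> /fsubsetP xF vF; apply/eqP; rewrite -[_ == _]negbK -mem_finsupp.
by apply: contra vF; exact: xF.
Qed.

Lemma coord_sum F x : closed_simplex F x -> \sum_(v <- F) x v = 1.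
Proof.
move=> xF; have /and3P[_ _ /eqP <-] := coordP x.
apply/esym/big_fset_incl => // v vF; rewrite mem_finsupp negbK.
by move/eqP.
Qed.

Lemma closed_simplex_neq0 F x :
  closed_simplex F x -> F != fset0.
Proof.
move=> xF; apply/eqP => F0; have := coord_sum xF.
by rewrite F0 big_seq_fset0 => /esym/eqP; rewrite oner_eq0.
Qed.

Lemma realization_ext x y : (forall v, x v = y v) -> x = y.
Proof. by move=> xy; apply/val_inj/fsfunP. Qed.

Lemma coord_continuous v : continuous (fun x : realization R K => x v : R).
Proof.
apply/continuous_closedP => C cC; apply/closed_realizationP => F KF.
exists ((fun u : {ptws V -> R} => u v) @^-1` C) => //.
apply: preimage_closed cC => y _; exact: (@proj_continuous V (fun=> R) v y).
Qed.

Lemma closed_closed_simplex F : closed (closed_simplex F : set (realization R K)).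
Proof.
rewrite (_ : closed_simplex F =
  \bigcap_(v in [set v | v \notin F]) (fun x : realization R K => x v : R) @^-1` [set 0]).
  apply: closed_bigI => v _; apply: preimage_closed.
    by move=> x _; exact: coord_continuous.
  exact: closed_eq.
apply/seteqP; split=> x; first by move=> xF v /= vF; exact: coord_notin vF.
move=> x0; apply/fsubsetP => v; rewrite mem_finsupp.
by apply: contraNT => /x0 /= ->.
Qed.

(** On a single closed simplex the weak topology is that of coordinatewise convergence, so
    coordinates suffice once [q] eventually stays in [F]. *)
Lemma cvg_simplex (T : Type) (Q : set_system T) (FQ : Filter Q)
    (q : T -> realization R K) F z :
  simplices K F -> closed_simplex F z -> (\forall t \near Q, closed_simplex F (q t)) ->
  (forall v, v \in F -> (q t v : R) @[t --> Q] --> (z v : R)) -> q @ Q --> z.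
Proof.
move=> KF zF qF cq O; rewrite nbhsE => -[U [oU Uz] UO].
have [C cC CU] := (oU : weak_open U) _ KF.
have qz : (fun t => (q t : {ptws V -> R})) @ Q --> (z : {ptws V -> R}).
  apply/cvg_sup => v W [_ [[X oX <-]] /= Xz XW].
  apply: (filterS XW); rewrite /=.
  have [vF|vF] := boolP (v \in F).
    by apply: (cq v vF); exact: open_nbhs_nbhs.
  (* Off [F] the coordinates of [z] and, eventually, those of [q t] vanish. *)
  apply: filterS qF => t qtF /=.
  by rewrite (coord_notin qtF) // -(coord_notin zF vF).
have Cz : ~ C (z : V -> R).
  move=> Cz; have /seteqP[_ /(_ z (conj Cz zF))] := CU.
  by case=> /(_ Uz).
have oC : open (~` C) by exact: closed_openC.
have nC : \forall t \near Q, ~ C (q t : V -> R).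
  exact: (qz _ (open_nbhs_nbhs (conj oC Cz))).
change (\forall t \near Q, O (q t)); near=> t; apply: UO; apply: contrapT => nU.
have tF : closed_simplex F (q t) by near: t.
have nCt : ~ C (q t) by near: t.
by have /seteqP[/(_ (q t) (conj nU tF))[]] := CU.
Unshelve. all: by end_near. Qed.

Lemma within_continuous_simplex (X : topologicalType) (A : set X)
    (q : X -> realization R K) F :
  simplices K F -> (forall t, A t -> closed_simplex F (q t)) ->
  (forall v, v \in F -> {within A, continuous (fun t => q t v : R)}) ->
  {within A, continuous q}.
Proof.
move=> KF qF cq; apply/subspace_continuousP => t At.
apply: cvg_simplex KF (qF t At) _ _.
  by apply: filterS (withinT A (nbhs_filter t)).
by move=> v vF; have /subspace_continuousP := cq v vF; exact.
Qed.

(** The weak topology is defined through closed sets of coordinate functions; the witness here is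
    the closure of the coordinates of the points of [F] outside [U]. *)
Lemma open_realization (U : set (realization R K)) :
  (forall F x, simplices K F -> closed_simplex F x -> U x ->
    \forall y \near within (closed_simplex F) (nbhs x), U y) -> open U.
Proof.
move=> oU; change (weak_open U) => F KF.
pose D := [set u : {ptws V -> R} | exists2 y, closed_simplex F y /\ ~ U y &
  u = (y : V -> R)].
exists (closure D); first exact: closed_closure.
apply/seteqP; split=> x [xU xF]; split=> //.
  by apply: subset_closure; exists x.
move=> /= Ux.
(* Traces on [F] of the pointwise neighbourhoods of [x]. By [cvg_simplex] they converge weakly to
   [x], so [U] holds on one of them, which contradicts [x] being in the closure of [D]. *)
pose Q := filter_from (nbhs (x : {ptws V -> R}))
  (fun N => [set y : realization R K | closed_simplex F y /\ N (y : V -> R)]).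
have FQ : Filter Q.
  apply: filter_from_filter; first by exists setT; exact: filterT.
  by move=> A B nA nB; exists (A `&` B); [exact: filterI|move=> y [yF [? ?]]].
have QF : Q (closed_simplex F) by exists setT; [exact: filterT|move=> y []].
have /(_ (fun y => closed_simplex F y -> U y)) : id @ Q --> x.
  apply: (cvg_simplex _ KF) => // v vF W nW.
  have /(_ _ nW) := @proj_continuous V (fun=> R) v (x : {ptws V -> R}).
  by move=> nW'; exists ((fun u : {ptws V -> R} => u v) @^-1` W) => // y [].
case; first exact: oU.
move=> N nN NU; have [_ [[y [yF nUy] ->] Ny]] := xU _ nN.
by apply: nUy; exact: (NU y).
Qed.

Lemma continuous_realization (Z : topologicalType) (g : realization R K -> Z) :
  (forall F, simplices K F -> {within closed_simplex F, continuous g}) -> continuous g.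
Proof.
move=> cg; apply/continuousP => O oO; apply: open_realization => F x KF xF gx.
by move/subspace_continuousP: (cg F KF) => /(_ x xF); apply; exact: open_nbhs_nbhs.
Qed.

End RealizationTopology.

(** Compactness of the interval is the reason: by the tube lemma, the product of the interval with a
    weak topology can be tested one closed simplex at a time. *)
Lemma continuous_homotopy (R : realType) (V : choiceType) (K : scomplex V)
    (Z : topologicalType) (H : R * realization R K -> Z) :
  (forall F, simplices K F ->
    {within `[0, 1] `*` closed_simplex F, continuous H}) ->
  {within `[0, 1] `*` [set: realization R K], continuous H}.
Proof.
move=> cH; apply/subspace_continuousP => -[t0 x0] [It0 _] O /=.
rewrite nbhsE => -[U [oU UH] UO].
have nearH F t x : simplices K F -> t \in `[0, 1] -> closed_simplex F x -> U (H (t, x)) ->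
    exists2 M : set R, nbhs t M & exists2 N : set (realization R K), nbhs x N &
      forall s y, M s -> N y -> s \in `[0, 1] -> closed_simplex F y -> U (H (s, y)).
  move=> KF It xF Utx.
  have /subspace_continuousP/(_ (t, x) (conj It xF)) := cH F KF.
  move=> /(_ U (open_nbhs_nbhs (conj oU Utx))) [[M N] /= [nM nN] MN].
  by exists M => //; exists N => // s y Ms Ny Is yF; exact: (MN (s, y)).
have [M nM [N nN MN]] := nearH _ _ _ (supp_simplex x0) It0 (fsubset_refl _) UH.
have [e /= e0 eM] : nbhs_ball t0 M by apply/nbhs_ballP.
(* [M] contains the ball of radius [e] at [t0]; half that radius gives a compact interval inside
   [M]. *)
pose J : set R := `[0, 1] `&` `[t0 - e / 2, t0 + e / 2].
have cJ : compact J.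
  by apply: compact_closedI; [exact: segment_compact|exact: itv_closed].
(* The tube lemma over [J] in each closed simplex makes [W] open, and the part over the unit
   interval of [ball t0 (e / 2)] times [W] is sent into [U]. *)
pose W := [set x | forall t, J t -> U (H (t, x))].
have oW : open W.
  apply: open_realization => F x KF xF Wx.
  have := (compact_near_coveringP J).1 cJ _ (within (closed_simplex F) (nbhs x))
    (fun y t => J t -> U (H (t, y))) _.
  have P0 : forall t, J t -> \forall t' \near t &
      y \near within (closed_simplex F) (nbhs x), J t' -> U (H (t', y)).
    move=> t Jt.
    have [M' nM' [N' nN' MN']] := nearH F t x KF (proj1 Jt) xF (Wx t Jt).
    exists (M', [set y | closed_simplex F y /\ N' y]) => /=.
      split=> //; rewrite /within /=.
      by apply: filterS nN' => y N'y yF.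
    by move=> [t' y] /= [M't' [yF N'y]] Jt'; apply: MN' => //; exact: (proj1 Jt').
  move=> /(_ (within_filter _ (nbhs_filter x)) P0); apply: filterS => y + t Jt.
  by move=> /(_ t Jt) /(_ Jt).
have Wx0 : W x0.
  move=> t [It]; rewrite /= in_itv /= => /andP[t1 t2].
  apply: MN => //; last exact: fsubset_refl; last exact: nbhs_singleton.
  by apply: eM; rewrite /ball /= ltr_norml; apply/andP; split; lra.
exists (ball t0 (e / 2), W) => /=.
  by split; [apply: nbhsx_ballx; lra|exact: open_nbhs_nbhs].
move=> [t y] /= [tb Wy] [It _]; apply: UO; apply: Wy; split=> //.
move: tb; rewrite /ball /= ltr_norml in_itv /= => /andP[? ?].
by apply/andP; split; lra.
Qed.

(** * Homotopies *)

Lemma within_continuous_eq (X Y : topologicalType) (A : set X) (f g : X -> Y) :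
  (forall x, A x -> f x = g x) ->
  {within A, continuous f} -> {within A, continuous g}.
Proof. by move=> fg; apply: subspace_eq_continuous => x /set_mem; exact: fg. Qed.

Lemma within_continuous_comp (X Y Z : topologicalType) (A : set X) (B : set Y)
    (f : X -> Y) (g : Y -> Z) :
  (forall x, A x -> B (f x)) -> {within A, continuous f} ->
  {within B, continuous g} -> {within A, continuous (g \o f)}.
Proof.
move=> AB /subspace_continuousP cf /subspace_continuousP cg.
apply/subspace_continuousP => x Ax O /(cg (f x) (AB x Ax)) gO.
apply: filterS2 (withinT A (nbhs_filter x)) (cf x Ax _ gO) => y Ay /=.
by apply; exact: AB.
Qed.

Section Homotopies.
Variable R : realType.

Lemma continuous_affine_fst (X : topologicalType) (a b : R) :
  continuous (fun p : R * X => (a * p.1 + b, p.2)).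
Proof.
move=> p; apply: (@cvg_pair _ _ _ (nbhs p) (nbhs (a * p.1 + b : R)) (nbhs p.2)); last exact: cvg_snd.
by apply: cvgD; [apply: cvgM; [exact: cvg_cst|exact: cvg_fst]|exact: cvg_cst].
Qed.

Lemma closed_setXT (X : topologicalType) (A : set R) :
  closed A -> closed (A `*` [set: X]).
Proof.
move=> cA; rewrite (_ : _ `*` _ = fst @^-1` A); last first.
  by apply/seteqP; split=> [[t x] []|[t x]].
by apply: preimage_closed cA => p _; exact: cvg_fst.
Qed.

Lemma homotopic_trans (X Y : topologicalType) (f g h : X -> Y) :
  homotopic R f g -> homotopic R g h -> homotopic R f h.
Proof.
move=> [H [cH H0 H1]] [H' [cH' H'0 H'1]].
(* The summand [0] gives both reparametrizations the form treated by [continuous_affine_fst]. *)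
pose D (p : R * X) := if p.1 <= 1 / 2 then H (2 * p.1 + 0, p.2)
  else H' (2 * p.1 + -1, p.2).
exists D; split; last 2 first.
- by move=> x; rewrite /D /= ifT ?mulr0 ?addr0//; lra.
- move=> x; rewrite /D /= ifF; last by apply/negbTE; rewrite -ltNge; lra.
  by rewrite -H'1; congr (H' (_, _)); lra.
have -> : `[0, 1] `*` [set: X] =
    (`[(0 : R), 1 / 2] `*` [set: X]) `|` (`[(1 / 2 : R), 1] `*` [set: X]).
  apply/seteqP; split=> [[t x] /=|[t x] /= [] []]; rewrite !in_itv /=.
  - case=> /andP[? ?] _; have [?|?] := leP t (1 / 2); [left|right]; split=> //; lra.
  - by move=> /andP[? ?] _; split=> //; lra.
  - by move=> /andP[? ?] _; split=> //; lra.
apply: withinU_continuous.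
- by apply: closed_setXT; exact: itv_closed.
- by apply: closed_setXT; exact: itv_closed.
- apply: (@within_continuous_eq _ _ _ (H \o (fun p : R * X => (2 * p.1 + 0, p.2)))).
    move=> [t x] [/=]; rewrite in_itv /= => /andP[? ?] _.
    by rewrite /D /= ifT.
  apply: within_continuous_comp cH; last first.
    by apply: continuous_subspaceT; exact: continuous_affine_fst.
  by move=> [t x] /=; rewrite !in_itv /= => -[/andP[? ?] _]; split=> //; lra.
- apply: (@within_continuous_eq _ _ _ (H' \o (fun p : R * X => (2 * p.1 + -1, p.2)))).
    move=> [t x] [/=]; rewrite in_itv /= => /andP[t1 ?] _.
    rewrite /D /=; case: leP => // t2.
    have -> : t = 1 / 2 by lra.
    transitivity (H' (0, x)); first by congr (H' (_, _)); lra.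
    by rewrite H'0 -H1; congr (H (_, _)); lra.
  apply: within_continuous_comp cH'; last first.
    by apply: continuous_subspaceT; exact: continuous_affine_fst.
  by move=> [t x] /=; rewrite !in_itv /= => -[/andP[? ?] _]; split=> //; lra.
Qed.

Lemma homotopic_compl (X Y Z : topologicalType) (f g : X -> Y) (k : Y -> Z) :
  continuous k -> homotopic R f g -> homotopic R (k \o f) (k \o g).
Proof.
move=> ck [H [cH H0 H1]]; exists (k \o H); split=> [|x|x] /=; last 2 first.
- by rewrite H0.
- by rewrite H1.
by apply: (within_continuous_comp (B := setT)) cH _ => //; exact: continuous_subspaceT.
Qed.

Lemma homotopic_compr (X Y Z : topologicalType) (f g : Y -> Z) (k : X -> Y) :
  continuous k -> homotopic R f g -> homotopic R (f \o k) (g \o k).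
Proof.
move=> ck [H [cH H0 H1]].
exists (H \o (fun p : R * X => (p.1, k p.2))); split=> [|x|x] /=; last 2 first.
- by rewrite H0.
- by rewrite H1.
apply: within_continuous_comp cH; first by move=> [t x] [].
apply: continuous_subspaceT => p.
apply: (@cvg_pair _ _ _ (nbhs p) (nbhs p.1) (nbhs (k p.2))); first exact: cvg_fst.
by apply: (@continuous_comp _ _ _ snd k p); [exact: cvg_snd|exact: ck].
Qed.

End Homotopies.

(** * Points with prescribed barycentric coordinates *)

Lemma barycentric_fsfun (R : realType) (V : choiceType) (K : scomplex V)
    (F : {fset V}) (u : V -> R) :
  simplices K F -> (forall w, w \in F -> 0 <= u w) -> \sum_(w <- F) u w = 1 ->
  barycentric K ([fsfun v in F => u v | 0] : {fsfun V -> R with 0}).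
Proof.
move=> KF u0 u1.
have sF : (finsupp ([fsfun v in F => u v | 0] : {fsfun V -> R with 0}) `<=` F)%fset.
  by apply/fsubsetP => w; rewrite mem_finsupp fsfunE; case: ifP => // _; rewrite eqxx.
have e1 : \sum_(w <- finsupp ([fsfun v in F => u v | 0] : {fsfun V -> R with 0}))
    [fsfun v in F => u v | 0] w = 1.
  rewrite -u1 (big_fset_incl _ sF); last first.
    by move=> w wF; rewrite mem_finsupp negbK => /eqP.
  by rewrite !big_seq; apply: eq_bigr => w wF; rewrite fsfunE wF.
apply/and3P; split; last exact/eqP.
- apply/asboolP; apply: simplex_face KF sF _; apply/eqP => F0.
  by move/eqP: e1; rewrite F0 big_seq_fset0 eq_sym oner_eq0.
- by apply/asboolP => w; rewrite fsfunE; case: ifP => // /u0.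
Qed.

(* [x0] is the junk value taken when [u] does not restrict to barycentric
   coordinates on [F]. *)
Definition realize (R : realType) (V : choiceType) (K : scomplex V)
    (x0 : realization R K) (F : {fset V}) (u : V -> R) : realization R K :=
  insubd x0 ([fsfun v in F => u v | 0] : {fsfun V -> R with 0}).

Lemma realizeE (R : realType) (V : choiceType) (K : scomplex V)
    (x0 : realization R K) F u v :
  simplices K F -> (forall w, w \in F -> 0 <= u w) -> \sum_(w <- F) u w = 1 ->
  realize x0 F u v = if v \in F then u v else 0.
Proof.
move=> KF u0 u1; have /(insubdK x0) := barycentric_fsfun KF u0 u1.
by move=> /(congr1 (fun h : {fsfun V -> R with 0} => h v)); rewrite fsfunE.
Qed.

Lemma realize_closed_simplex (R : realType) (V : choiceType) (K : scomplex V)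
    (x0 : realization R K) F u :
  simplices K F -> (forall w, w \in F -> 0 <= u w) -> \sum_(w <- F) u w = 1 ->
  closed_simplex F (realize x0 F u).
Proof.
move=> KF u0 u1; apply/fsubsetP => v; rewrite mem_finsupp realizeE //.
by case: ifP => // _; rewrite eqxx.
Qed.

(** * Contractible subcomplexes *)

Section Cone.
Variables (R : realType) (V : choiceType) (K : scomplex V) (a : V).
Hypothesis Ka : simplices K [fset a]%fset.
Hypothesis Kcone : forall F, simplices K F -> simplices K (a |` F)%fset.

Let mix (p : R * realization R K) (v : V) : R :=
  (1 - p.1) * p.2 v + p.1 * (v == a)%:R.

Let mix_continuous v : continuous (mix ^~ v).
Proof.
move=> p; rewrite /mix; apply: cvgD; apply: cvgM.
- by apply: cvgB; [exact: cvg_cst|exact: cvg_fst].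
- apply: (@continuous_comp _ _ _ snd (fun x : realization R K => x v : R) p).
    exact: cvg_snd.
  exact: coord_continuous.
- exact: cvg_fst.
- exact: cvg_cst.
Qed.

Let indicator_sum (F : {fset V}) : \sum_(v <- (a |` F)%fset) (v == a)%:R = 1 :> R.
Proof.
rewrite (big_fsetD1 a) ?fset1U1 //= eqxx big_seq big1 ?addr0 // => v.
by rewrite !inE; case: eqP.
Qed.

Let mix_ge0 p v : p.1 \in `[0, 1] -> 0 <= mix p v.
Proof.
rewrite in_itv /= => /andP[? ?]; apply: addr_ge0; apply: mulr_ge0 => //.
  by rewrite subr_ge0.
exact: coord_ge0.
Qed.

Let mix_sum p F : closed_simplex F p.2 -> \sum_(v <- (a |` F)%fset) mix p v = 1.
Proof.
move=> pF; rewrite big_split /= -!mulr_sumr indicator_sum coord_sum.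
  by rewrite !mulr1 subrK.
exact: fsubset_trans pF (fsubsetU1 _ _).
Qed.

Let H (p : R * realization R K) := realize p.2 (a |` finsupp p.2)%fset (mix p).

Let HE p v : p.1 \in `[0, 1] -> H p v = mix p v.
Proof.
move=> p1; rewrite /H realizeE; last 3 first.
- exact/Kcone/supp_simplex.
- by move=> w _; exact: mix_ge0.
- by apply: mix_sum; exact: fsubset_refl.
case: ifPn => //; rewrite !inE negb_or => /andP[/negPf va vp].
by rewrite /mix va (coord_notin (fsubset_refl _) vp) !mulr0 addr0.
Qed.

(** The straight-line homotopy to the apex [a] stays in the complex, because [Kcone] puts [a] and
    the support of any point in a common simplex. *)
Lemma cone_contractible : contractible R (realization R K).
Proof.
have b1 : barycentric K ([fsfun v in [fset a]%fset => (v == a)%:R | 0] : {fsfun V -> R with 0}).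
  by apply: barycentric_fsfun => //; rewrite -(fsetU0 [fset a]%fset) indicator_sum.
exists (Realization b1), H; split.
- apply: continuous_homotopy => F KF.
  apply: (within_continuous_simplex (Kcone KF)).
    move=> [t x] [/= It xF].
    apply: (fsubset_trans (realize_closed_simplex _ _ _ _)).
    + exact/Kcone/supp_simplex.
    + by move=> w _; exact: mix_ge0.
    + by apply: mix_sum; exact: fsubset_refl.
    + exact: fsetUS.
  move=> v _; apply: (@within_continuous_eq _ _ _ (mix ^~ v)).
    by move=> p [p1 _]; rewrite HE.
  exact: continuous_subspaceT.
- move=> x; apply: realization_ext => v.
  by rewrite HE ?in_itv /= ?lexx ?ler01 // /mix /= subr0 mul1r mul0r addr0.
- move=> x; apply: realization_ext => v.
  rewrite HE ?in_itv /= ?lexx ?ler01 // /mix /= subrr mul0r mul1r add0r.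
  by rewrite fsfunE inE; case: eqP.
Qed.

End Cone.

Lemma within_continuous_pair (X Y Z : topologicalType) (A : set X)
    (f : X -> Y) (g : X -> Z) :
  {within A, continuous f} -> {within A, continuous g} ->
  {within A, continuous (fun x => (f x, g x))}.
Proof.
move=> /subspace_continuousP cf /subspace_continuousP cg.
by apply/subspace_continuousP => x Ax; apply: cvg_pair; [exact: cf|exact: cg].
Qed.

(** * Realization of a subcomplex *)

Section Subcomplex.
Variables (R : realType) (V : choiceType) (M L : scomplex V).
Hypothesis ML : simplices M `<=` simplices L.

Lemma incl_barycentric (x : realization R M) : barycentric L x.
Proof.
have /and3P[/asboolP Mx ? ?] := coordP x.
by apply/and3P; split=> //; apply/asboolP/ML.
Qed.

Definition incl (x : realization R M) : realization R L :=
  Realization (incl_barycentric x).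

Lemma incl_continuous : continuous incl.
Proof.
apply: continuous_realization => F MF.
apply: (within_continuous_simplex (ML MF)) => // v _.
by apply: continuous_subspaceT; exact: coord_continuous.
Qed.

(* The inverse of [incl] on its range; [x0] is a junk value. *)
Definition restr (x0 : realization R M) (y : realization R L) :
  realization R M := insubd x0 (\val y).

Lemma restrE x0 (y : realization R L) : simplices M (finsupp y) ->
  (restr x0 y : {fsfun V -> R with 0}) = y.
Proof.
move=> My; have /and3P[_ ? ?] := coordP y.
by apply: insubdK; rewrite unfold_in; apply/and3P; split=> //; exact/asboolP.
Qed.

(** With [incl_continuous], this says that |M| has the topology induced from |L|. A simplex of [L]
    has finitely many faces, and those in [M] are closed and cover its part in |M|. *)
Lemma restr_continuous x0 :
  {within [set y : realization R L | simplices M (finsupp y)],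
    continuous (restr x0)}.
Proof.
apply/subspace_continuousP => x /= Mx O; rewrite nbhsE => -[U [oU Ux] UO].
pose W := [set y : realization R L | simplices M (finsupp y) -> U (restr x0 y)].
have oW : open W.
  apply: open_realization => F z LF zF Wz.
  have : \forall y \near within (closed_simplex F) (nbhs z),
      (\bigcap_(E in [set` fpowerset F])
        [set y | simplices M E -> closed_simplex E y -> U (restr x0 y)]) y.
    (* A face outside [M] imposes nothing, a face missing [z] is closed and so avoided near [z], and
       on the other faces [restr] keeps the coordinates. *)
    apply: filter_bigI => E; rewrite fpowersetE => EF.
    have [ME|nME] := pselect (simplices M E); last by apply: nearW => y ME.
    have [zE|nzE] := pselect (closed_simplex E z); last first.
      apply: cvg_within.
      have : nbhs z (~` closed_simplex E).
        by apply: open_nbhs_nbhs; split=> //; exact/closed_openC/closed_closed_simplex.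
      by apply: filterS => y nyE _ /nyE.
    have sub y : closed_simplex E y -> simplices M (finsupp y).
      move=> yE; apply: simplex_face ME yE _.
      exact: closed_simplex_neq0 (fsubset_refl (finsupp y)).
    have cE : {within (closed_simplex E : set (realization R L)),
        continuous (restr x0)}.
      apply: (within_continuous_simplex ME).
        by move=> y yE; rewrite /closed_simplex /= restrE //; exact: sub.
      move=> v _; apply: (@within_continuous_eq _ _ _ (fun y : realization R L => y v : R)).
        by move=> y yE; rewrite restrE //; exact: sub.
      by apply: continuous_subspaceT; exact: coord_continuous.
    have /subspace_continuousP/(_ z zE U) := cE.
    have Uz : nbhs (restr x0 z) U by apply: open_nbhs_nbhs; split=> //; exact/Wz/sub.
    move=> /(_ Uz) nU; apply: cvg_within.
    have nU' : nbhs z [set y | closed_simplex E y -> U (restr x0 y)] := nU.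
    by apply: filterS nU' => y yU _ /yU.
  apply: filterS2 (withinT (closed_simplex F) (nbhs_filter z)) => y yF yU My.
  have yP : [set` fpowerset F] (finsupp y) by rewrite /= fpowersetE.
  exact: yU yP My (fsubset_refl _).
have nW : nbhs x W by apply: open_nbhs_nbhs; split.
have nW' : nbhs x [set y : realization R L | simplices M (finsupp y) -> O (restr x0 y)].
  by apply: filterS nW => y Wy My; apply: UO; exact: Wy.
exact: nW'.
Qed.

(** Transporting the contraction of |M| into |L| lets the contractions of all the subcomplexes
    [Phi F] live on one type. *)
Lemma contractible_subcomplex : contractible R (realization R M) ->
  exists (c : realization R L) (H : R * realization R L -> realization R L),
  [/\ simplices M (finsupp c),
    {within `[0, 1] `*` [set y : realization R L | simplices M (finsupp y)],
      continuous H},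
    forall t (y : realization R L), t \in `[0, 1] -> simplices M (finsupp y) ->
      simplices M (finsupp (H (t, y))),
    forall y : realization R L, simplices M (finsupp y) -> H (0, y) = y &
    forall y : realization R L, simplices M (finsupp y) -> H (1, y) = c].
Proof.
move=> [x0 [h [ch h0 h1]]].
exists (incl x0), (incl \o (h \o (fun p => (p.1, restr x0 p.2)))); split=> /=.
- exact: supp_simplex.
- apply: (within_continuous_comp (B := setT)) => //; last first.
    by apply: continuous_subspaceT; exact: incl_continuous.
  apply: within_continuous_comp ch; first by move=> [t y] [].
  apply: within_continuous_pair.
    by apply: continuous_subspaceT => p; exact: cvg_fst.
  apply: (@within_continuous_comp _ _ _ _ [set y : realization R L |
      simplices M (finsupp y)] snd (restr x0)); last exact: restr_continuous.
    by move=> [t y] [].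
  by apply: continuous_subspaceT => p; exact: cvg_snd.
- by move=> t y _ _; exact: supp_simplex.
- move=> y My; apply: realization_ext => v /=.
  by rewrite h0 restrE.
- by move=> y My; rewrite h1.
Qed.

End Subcomplex.

(** * Extension of maps over a carrier *)

(** Pasting lemma: near [x] the closed pieces missing [x] are avoided, and finitely many conditions
    remain. *)
Lemma within_continuous_fcover (X Z : topologicalType) (I : choiceType)
    (S : {fset I}) (B : I -> set X) (D : set X) (f : X -> Z) :
  (forall i, i \in S -> closed (B i)) ->
  (forall i, i \in S -> {within B i, continuous f}) ->
  (forall x, D x -> exists2 i, i \in S & B i x) ->
  {within D, continuous f}.
Proof.
move=> cB cf DB; apply/subspace_continuousP => x Dx O nO.
have nS : \forall y \near x, (\bigcap_(i in [set` S]) [set y | B i y -> O (f y)]) y.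
  apply: filter_bigI => i iS.
  have [Bx|nBx] := pselect (B i x).
    by have /subspace_continuousP/(_ x Bx O nO) := cf i iS.
  have : nbhs x (~` B i).
    by apply: open_nbhs_nbhs; split=> //; exact/closed_openC/cB.
  by apply: filterS => y nBy /nBy.
have nS' : nbhs x [set y | D y -> O (f y)].
  apply: filterS nS => y yS Dy; have [i iS Biy] := DB y Dy.
  exact: (yS i iS Biy).
exact: nS'.
Qed.

Lemma within_continuous_open_cover (X Z : topologicalType) (D : set X)
    (f : X -> Z) :
  (forall x, D x -> exists O, [/\ open O, O x & {within D `&` O, continuous f}]) ->
  {within D, continuous f}.
Proof.
move=> DO; apply/subspace_continuousP => x Dx U nU.
have [O [oO Ox cf]] := DO x Dx.
have /subspace_continuousP/(_ x (conj Dx Ox) U nU) cU := cf.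
have {}cU : nbhs x [set y | (D `&` O) y -> U (f y)] := cU.
have nO : nbhs x O by exact: open_nbhs_nbhs.
have nU' : nbhs x [set y | D y -> U (f y)].
  by apply: filterS2 cU nO => y yU Oy Dy; exact: yU.
exact: nU'.
Qed.

(** * Radial projection of a simplex onto its boundary *)

Section RadialProjection.
Variables (R : realType) (V : choiceType) (K : scomplex V) (F : {fset V}).
Hypothesis KF : simplices K F.
Implicit Types x : realization R K.

Definition min_coord x : R := \big[Num.min/1]_(v <- F) x v.

(* [radius x] vanishes on the boundary of [F] and is 1 at its barycenter. *)
Definition radius x : R := #|` F|%:R * min_coord x.

(** The projection from the barycenter of [F]: subtracting the least coordinate from all of them
    kills at least one, and [1 - radius x] is the sum that remains. *)
Definition boundary_proj x : realization R K :=
  realize x F (fun v => (x v - min_coord x) / (1 - radius x)).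

Lemma min_coord_le x v : v \in F -> min_coord x <= x v.
Proof.
move=> vF; have {vF} : v \in (F : seq V) by [].
rewrite /min_coord; elim: (F : seq V) => // w s IH; rewrite big_cons inE ge_min.
by case/orP => [/eqP ->|/IH ->]; rewrite ?lexx ?orbT.
Qed.

(** The first case is the initial value of the iterated minimum; [boundary_proj_boundary] excludes
    it, since the radius would then be at least 1. *)
Lemma min_coord_attained x :
  min_coord x = 1 \/ exists2 v, v \in F & min_coord x = x v.
Proof.
suff: min_coord x = 1 \/ exists2 v, v \in (F : seq V) & min_coord x = x v by [].
rewrite /min_coord; elim: (F : seq V) => [|w s IH]; first by left; rewrite big_nil.
rewrite big_cons; case: leP => _.
  by right; exists w => //; rewrite mem_head.
case: IH => [->|[v vs ->]]; first by left.
by right; exists v => //; rewrite inE vs orbT.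
Qed.

Lemma min_coord_ge0 x : 0 <= min_coord x.
Proof. by case: (min_coord_attained x) => [->|[v _ ->]]; rewrite ?coord_ge0. Qed.

Lemma radius_ge0 x : 0 <= radius x.
Proof. by apply: mulr_ge0; [exact: ler0n|exact: min_coord_ge0]. Qed.

Lemma min_coord_continuous : continuous min_coord.
Proof.
apply: (continuous_big (op := Num.min)) => [|v _]; last exact: coord_continuous.
exact: min_continuous.
Qed.

Lemma radius_continuous : continuous radius.
Proof.
move=> x; apply: (@cvgM _ _ (nbhs x) _ (fun=> #|` F|%:R : R) min_coord).
  exact: cvg_cst.
exact: min_coord_continuous.
Qed.

Lemma min_coord_boundary x : closed_simplex F x -> finsupp x != F -> min_coord x = 0.
Proof.
move=> xF nx; have [v vF vx] : exists2 v, v \in F & v \notin finsupp x.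
  apply/fsubsetPn; apply: contra nx => Fx; rewrite eqEfsubset Fx andbT; exact: xF.
apply/eqP; rewrite eq_le min_coord_ge0 andbT.
by rewrite -(coord_notin (fsubset_refl _) vx) min_coord_le.
Qed.

Lemma boundary_proj_id x : min_coord x = 0 -> closed_simplex F x ->
  boundary_proj x = x.
Proof.
move=> m0 xF; have r0 : radius x = 0 by rewrite /radius m0 mulr0.
have q v : (x v - min_coord x) / (1 - radius x) = x v.
  by rewrite m0 r0 !subr0 divr1.
apply: realization_ext => v; rewrite /boundary_proj realizeE //.
- by rewrite q; case: ifPn => // /(coord_notin xF).
- by move=> w _; rewrite q coord_ge0.
- by rewrite (eq_bigr (fun w => x w)) ?coord_sum.
Qed.

Section Interior.
Variable x : realization R K.
Hypotheses (xF : closed_simplex F x) (x1 : radius x < 1).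

Let proj_ge0 v : v \in F -> 0 <= (x v - min_coord x) / (1 - radius x).
Proof.
move=> vF; apply: divr_ge0; last by rewrite subr_ge0 ltW.
by rewrite subr_ge0 min_coord_le.
Qed.

Let proj_sum : \sum_(v <- F) (x v - min_coord x) / (1 - radius x) = 1.
Proof.
rewrite -mulr_suml sumrB coord_sum // big_const_seq count_predT iter_addr_0.
by rewrite -mulr_natl divff // subr_eq0 eq_sym lt_eqF.
Qed.

Lemma boundary_projE v : v \in F ->
  boundary_proj x v = (x v - min_coord x) / (1 - radius x).
Proof. by move=> vF; rewrite /boundary_proj realizeE // vF. Qed.

Lemma boundary_proj_closed : closed_simplex F (boundary_proj x).
Proof. exact: realize_closed_simplex. Qed.

Lemma boundary_proj_boundary : (finsupp (boundary_proj x) `<` F)%fset.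
Proof.
rewrite fproperEneq boundary_proj_closed andbT.
have [m1|[v vF mv]] := min_coord_attained x.
  exfalso; move: x1; rewrite /radius m1 mulr1 ltNge ler1n cardfs_gt0.
  by rewrite (closed_simplex_neq0 xF).
apply/eqP => /fsetP/(_ v); rewrite vF mem_finsupp boundary_projE //.
by rewrite mv subrr mul0r eqxx.
Qed.

End Interior.

(** The bound [3 / 4] keeps the denominator [1 - radius x] away from 0 and is the threshold used in
    [extend_fuel]. *)
Lemma boundary_proj_continuous :
  {within closed_simplex F `&` [set x | radius x < 3 / 4], continuous boundary_proj}.
Proof.
apply: (within_continuous_simplex KF).
  by move=> x [xF /= rx]; apply: boundary_proj_closed => //; lra.
move=> v vF.
apply: (@within_continuous_eq _ _ _
    (fun x => (x v - min_coord x) / (1 - radius x))).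
  by move=> x [xF /= rx]; rewrite boundary_projE //; lra.
apply/subspace_continuousP => x [xF /= rx].
apply: (cvg_trans (cvg_app _ (cvg_within _))).
apply: cvgM; first by apply: cvgB; [exact: coord_continuous|exact: min_coord_continuous].
apply: cvgV; first by apply/eqP; lra.
by apply: cvgB; [exact: cvg_cst|exact: radius_continuous].
Qed.

End RadialProjection.

(** * Extension by induction on simplices *)

Section Extension.
Variables (R : realType) (V W : choiceType) (K : scomplex V) (L : scomplex W).
Variables (A : set {fset V}) (Phi : {fset V} -> scomplex W).
Variable f0 : realization R K -> realization R L.
Hypothesis A_face : forall F E, A F -> (E `<=` F)%fset -> E != fset0 -> A E.
Hypothesis f0_continuous : forall F, simplices K F -> A F ->
  {within closed_simplex F, continuous f0}.
Hypothesis f0_carried : forall x : realization R K, A (finsupp x) ->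
  simplices (Phi (finsupp x)) (finsupp (f0 x)).
Hypothesis Phi_mono : forall F E, simplices K F -> (E `<=` F)%fset ->
  E != fset0 -> simplices (Phi E) `<=` simplices (Phi F).

Let S F := [set y : realization R L | simplices (Phi F) (finsupp y)].

Variables (c : {fset V} -> realization R L).
Variables (H : {fset V} -> R * realization R L -> realization R L).
Hypothesis Sc : forall F, simplices K F -> S F (c F).
Hypothesis H_continuous : forall F, simplices K F ->
  {within `[0, 1] `*` S F, continuous (H F)}.
Hypothesis SH : forall F t y, simplices K F -> t \in `[0, 1] -> S F y ->
  S F (H F (t, y)).
Hypothesis H0 : forall F y, simplices K F -> S F y -> H F (0, y) = y.
Hypothesis H1 : forall F y, simplices K F -> S F y -> H F (1, y) = c F.

(* The contraction of [Phi F] is run along the rays from the barycenter of [F]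
   and finished halfway, so that continuity at the barycenter is trivial. *)
Fixpoint extend_fuel (n : nat) (x : realization R K) : realization R L :=
  if n is m.+1 then
    if `[< A (finsupp x) >] then f0 x
    else let F := finsupp x in
      if 3 / 4 <= radius F x then c F
      else H F (Num.min 1 (2 * radius F x), extend_fuel m (boundary_proj F x))
  else f0 x.

Definition extend (x : realization R K) := extend_fuel #|` finsupp x| x.

Lemma supp_gt0 (x : realization R K) : (0 < #|` finsupp x|)%N.
Proof. by rewrite cardfs_gt0; exact: simplex_neq0 (supp_simplex x). Qed.

Lemma card_boundary_proj (x : realization R K) : ~~ (3 / 4 <= radius (finsupp x) x) ->
  (#|` finsupp (boundary_proj (finsupp x) x)| < #|` finsupp x|)%N.
Proof.
rewrite -ltNge => rx; apply: fproper_ltn_card.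
by apply: boundary_proj_boundary; [exact: supp_simplex|exact: fsubset_refl|lra].
Qed.

(** Each projection strictly lowers the number of vertices of the support, so the value is settled
    as soon as the fuel reaches that number. *)
Lemma extend_fuel_stable n m (x : realization R K) :
  (#|` finsupp x| <= n)%N -> (#|` finsupp x| <= m)%N ->
  extend_fuel n x = extend_fuel m x.
Proof.
elim: n m x => [|n IH] [|m] x xn xm /=; rewrite ?leqn0 in xn xm *.
- by [].
- by have := supp_gt0 x; rewrite (eqP xn).
- by have := supp_gt0 x; rewrite (eqP xm).
case: ifP => // _; case: ifPn => // rx; congr (H _ (_, _)).
have px := card_boundary_proj rx.
by apply: IH; rewrite -ltnS; [exact: leq_trans px xn|exact: leq_trans px xm].
Qed.

Lemma extendE (x : realization R K) : extend x =
  if `[< A (finsupp x) >] then f0 x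
  else let F := finsupp x in
    if 3 / 4 <= radius F x then c F
    else H F (Num.min 1 (2 * radius F x), extend (boundary_proj F x)).
Proof.
rewrite {1}/extend; case n_x : #|` finsupp x| (supp_gt0 x) => [//|n] _ /=.
case: ifP => // _; case: ifPn => // rx; congr (H _ (_, _)).
apply: extend_fuel_stable => //; rewrite -ltnS -n_x; exact: card_boundary_proj.
Qed.

Lemma extend_eq (x : realization R K) : A (finsupp x) -> extend x = f0 x.
Proof. by move=> /asboolP Ax; rewrite extendE Ax. Qed.

Lemma min_radius_itv F (x : realization R K) :
  Num.min 1 (2 * radius F x) \in `[0, 1].
Proof.
rewrite in_itv /= ge_min lexx le_min ler01 andbT.
by apply: mulr_ge0; [lra|exact: radius_ge0].
Qed.

(** The projected point lies in a proper face, whose [Phi] is contained in that of the support, and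
    the contraction [H] does not leave the latter. *)
Lemma extend_carried (x : realization R K) : S (finsupp x) (extend x).
Proof.
have [n] := ubnP #|` finsupp x|; elim: n x => // n IH x xn.
rewrite extendE; case: ifPn => [/asboolP/f0_carried //|_] /=.
have Kx := supp_simplex x.
case: ifPn => rx; first exact: Sc.
apply: SH => //; first exact: min_radius_itv.
have px := card_boundary_proj rx.
have := IH _ (leq_trans px xn).
apply: Phi_mono => //; last exact: simplex_neq0 (supp_simplex _).
by apply: boundary_proj_closed => //; [exact: fsubset_refl|lra].
Qed.

Lemma extend_carriedW F (x : realization R K) :
  simplices K F -> closed_simplex F x -> S F (extend x).
Proof.
move=> KF xF; apply: Phi_mono (extend_carried x) => //.
exact: simplex_neq0 (supp_simplex x).
Qed.

(** [extend] refers to the support of [x], which may be a proper face of [F]. In that case the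
    radius is 0 and the projection fixes [x], so the formula for [F] is the contraction at time
    0. *)
Lemma extend_near_boundary F (x : realization R K) :
  simplices K F -> ~ A F -> closed_simplex F x -> radius F x < 3 / 4 ->
  extend x = H F (Num.min 1 (2 * radius F x), extend (boundary_proj F x)).
Proof.
move=> KF nAF xF rx; have [xE|nx] := eqVneq (finsupp x) F.
  by rewrite {1}extendE xE asboolF //= leNgt rx.
have m0 := min_coord_boundary xF nx.
rewrite boundary_proj_id // /radius m0 !mulr0 min_r // H0 //.
exact: extend_carriedW.
Qed.

(** Beyond radius [1 / 2] the contraction time is capped at 1, so the value is already [c F] before
    the threshold [3 / 4] is reached. *)
Lemma extend_near_barycenter F (x : realization R K) :
  simplices K F -> ~ A F -> closed_simplex F x -> 1 / 2 < radius F x ->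
  extend x = c F.
Proof.
move=> KF nAF xF rx; have xE : finsupp x = F.
  apply: contrapT => /eqP /(min_coord_boundary xF) m0.
  by move: rx; rewrite /radius m0 mulr0; lra.
rewrite extendE ifF; last by apply/asboolP; rewrite xE.
rewrite /= xE; case: ifPn => // nrx.
rewrite min_l; last lra.
apply: H1 => //; apply: extend_carriedW => //; apply: boundary_proj_closed => //.
by move: nrx; rewrite -ltNge; lra.
Qed.

Lemma extend_continuous : continuous extend.
Proof.
apply: continuous_realization => F KF.
have [n] := ubnP #|` F|; elim: n F KF => // n IH F KF Fn.
have [AF|nAF] := pselect (A F).
  apply: within_continuous_eq (f0_continuous KF AF) => x xF.
  rewrite extend_eq //; apply: A_face AF xF _.
  exact: simplex_neq0 (supp_simplex x).
(* The boundary is a finite union of closed facets, to which the induction hypothesis applies. *)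
have cbd : {within [set x : realization R K | closed_simplex F x /\ finsupp x != F],
    continuous extend}.
  apply: (within_continuous_fcover (S := [fset (F `\ v)%fset | v in F]%fset)
    (B := fun E => closed_simplex E)).
  - by move=> E _; exact: closed_closed_simplex.
  - move=> _ /imfsetP[v /= vF ->].
    (* The facet of a single vertex is empty and is not a simplex of [K], but it contains no
       point. *)
    have [F0|nF0] := eqVneq (F `\ v)%fset fset0.
      apply/subspace_continuousP => x xF; exfalso.
      by have := closed_simplex_neq0 xF; rewrite F0 eqxx.
    apply: IH; first exact: simplex_face KF (fsubsetDl _ _) nF0.
    by move: Fn; rewrite (cardfsD1 v F) vF.
  - move=> x [xF nx].
    have : ~~ (F `<=` finsupp x)%fset.
      by apply: contra nx => Fx; rewrite eqEfsubset Fx andbT; exact: xF.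
    case/fsubsetPn=> v vF vx; exists (F `\ v)%fset; first by apply/imfsetP; exists v.
    by rewrite /closed_simplex /= fsubsetD1 vx andbT; exact: xF.
have /continuousP radius_open := @radius_continuous R V K F.
(* The open sets [radius < 3 / 4] and [radius > 1 / 2] cover the simplex, and [extend] has a
   continuous expression on each. *)
apply: within_continuous_open_cover => x xF.
have [rx|rx] := ltP (radius F x) (3 / 4).
- exists [set y | radius F y < 3 / 4]; split=> //.
    exact: (radius_open _ (@open_lt _ (3 / 4))).
  apply: (@within_continuous_eq _ _ _ (H F \o (fun y =>
    (Num.min 1 (2 * radius F y), extend (boundary_proj F y))))).
    by move=> y [yF ry]; rewrite [RHS](extend_near_boundary KF nAF yF ry).
  apply: within_continuous_comp (H_continuous KF).
    move=> y [yF /= ry]; split=> /=; first exact: min_radius_itv.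
    by apply: extend_carriedW => //; apply: boundary_proj_closed => //; lra.
  apply: within_continuous_pair.
    apply: continuous_subspaceT => y.
    apply: (@continuous_comp _ _ _ (fun y => (1 : R, 2 * radius F y))
      (fun p : R * R => Num.min p.1 p.2) y); last exact: min_continuous.
    apply: (@cvg_pair _ _ _ (nbhs y) (nbhs (1 : R)) (nbhs (2 * radius F y))).
      exact: cvg_cst.
    apply: (@cvgM _ _ (nbhs y) _ (fun=> 2 : R) (radius F)); first exact: cvg_cst.
    exact: radius_continuous.
  apply: (within_continuous_comp _ (boundary_proj_continuous KF) cbd).
  move=> y [yF /= ry]; split; first by apply: boundary_proj_closed => //; lra.
  have : (finsupp (boundary_proj F y) `<` F)%fset by apply: boundary_proj_boundary => //; lra.
  by rewrite fproperEneq => /andP[].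
- exists [set y | 1 / 2 < radius F y]; split=> /=; last 2 first.
  + by lra.
  + apply: (@within_continuous_eq _ _ _ (fun=> c F)).
      by move=> y [yF ry]; rewrite (extend_near_barycenter KF nAF yF ry).
    by apply: continuous_subspaceT; exact: cst_continuous.
  exact: (radius_open _ (@open_gt _ (1 / 2))).
Qed.

End Extension.

(** * Acyclic carriers *)

Lemma exists_realization (R : realType) (V : choiceType) (K : scomplex V)
    (F : {fset V}) (u : V -> R) :
  simplices K F -> (forall v, 0 <= u v) -> (forall v, v \notin F -> u v = 0) ->
  \sum_(v <- F) u v = 1 ->
  exists x : realization R K, forall v, x v = u v.
Proof.
move=> KF u0 uF u1.
exists (Realization (barycentric_fsfun KF (fun w _ => u0 w) u1)) => v /=.
by rewrite fsfunE; case: ifPn => // /uF.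
Qed.

Lemma closed_simplexP (R : realType) (V : choiceType) (K : scomplex V)
    (F : {fset V}) (x : realization R K) :
  (forall v, v \notin F -> x v = 0) -> closed_simplex F x.
Proof.
move=> xF; apply/fsubsetP => v; rewrite mem_finsupp.
by apply: contraNT => /xF ->.
Qed.

(** * The cylinder over a complex *)

Section Cylinder.
Variables (V : choiceType) (K : scomplex V).

Definition shadow (E : {fset V * bool}) : {fset V} := [fset w.1 | w in E]%fset.

Definition prism (F : {fset V}) : {fset V * bool} :=
  [fset w in [seq (v, b) | v <- F, b <- [:: false; true]]]%fset.

Lemma mem_prism F w : (w \in prism F) = (w.1 \in F).
Proof.
rewrite in_fset -[LHS]/(w \in [seq (v, b) | v <- F, b <- [:: false; true]]).
apply/allpairsPdep/idP => [[v [b [vF _ ->]]] //|wF].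
by exists w.1, w.2; rewrite wF !inE; case: w wF => v [].
Qed.

Lemma sum_prism (R : nmodType) F (u : V * bool -> R) :
  \sum_(w <- prism F) u w = \sum_(v <- F) (u (v, false) + u (v, true)).
Proof.
transitivity (\sum_(w <- [seq (v, b) | v <- F, b <- [:: false; true]]) u w).
  apply: perm_big; apply: uniq_perm; first exact: fset_uniq.
    by apply: allpairs_uniq => // -[v b] [v' b'] _ _ [-> ->].
  by move=> w; rewrite in_fset.
by rewrite big_allpairs_dep; apply: eq_bigr => v _; rewrite big_cons big_seq1.
Qed.

Lemma shadow_prism F : shadow (prism F) = F.
Proof.
apply/fsetP => v; apply/imfsetP/idP => [[w /= + ->]|vF]; first by rewrite mem_prism.
by exists (v, true); rewrite //= mem_prism.
Qed.

Lemma shadowS E E' : (E `<=` E')%fset -> (shadow E `<=` shadow E')%fset.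
Proof.
move=> /fsubsetP EE'; apply/fsubsetP => _ /imfsetP[w /= /EE' wE ->].
by apply/imfsetP; exists w.
Qed.

Lemma shadow_neq0 E : E != fset0 -> shadow E != fset0.
Proof.
by case/fset0Pn=> w wE; apply/fset0Pn; exists w.1; apply/imfsetP; exists w.
Qed.

(** All of [prism F] spans a simplex, so this is larger than a triangulated product with an
    interval. It avoids ordering the vertices, and it suffices that it contains both ends and
    receives the slices below. *)
Definition cylinder_simplices : set {fset V * bool} :=
  [set E | E != fset0 /\ simplices K (shadow E)].

Lemma cylinder_neq0 E : cylinder_simplices E -> E != fset0.
Proof. by case. Qed.

Lemma cylinder_face (E E' : {fset V * bool}) : cylinder_simplices E ->
  (E' `<=` E)%fset -> E' != fset0 -> cylinder_simplices E'.
Proof.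
move=> [_ KE] E'E nE'; split=> //.
by apply: simplex_face KE (shadowS E'E) _; exact: shadow_neq0.
Qed.

Definition cylinder : scomplex (V * bool)%type :=
  SComplex cylinder_neq0 cylinder_face.

Lemma prism_simplex F : simplices K F -> simplices cylinder (prism F).
Proof.
move=> KF; split; last by rewrite shadow_prism.
have /fset0Pn[v vF] := simplex_neq0 KF.
by apply/fset0Pn; exists (v, true); rewrite mem_prism.
Qed.

Variable R : realType.

Lemma cylinder_projection : exists p : realization R cylinder -> realization R K,
  forall y v, p y v = y (v, false) + y (v, true).
Proof.
suff /choice[p pE] : forall y : realization R cylinder,
    exists x : realization R K, forall v, x v = y (v, false) + y (v, true).
  by exists p.
move=> y; have [_ Ky] := supp_simplex y.
apply: (exists_realization Ky) => [v|v vy|].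
- by apply: addr_ge0; exact: coord_ge0.
- have yv b : y (v, b) = 0.
    apply: (coord_notin (fsubset_refl _)); apply: contra vy => vb.
    by apply/imfsetP; exists (v, b).
  by rewrite !yv addr0.
- rewrite -sum_prism; apply: coord_sum; apply/fsubsetP => w wy.
  by rewrite mem_prism; apply/imfsetP; exists w.
Qed.

(** The point [x] is placed at height [t] by splitting each of its coordinates between the two
    levels in the ratio of [1 - t] to [t]. *)
Lemma cylinder_slice : exists j : R * realization R K -> realization R cylinder,
  forall t x w, t \in `[0, 1] -> j (t, x) w = (if w.2 then t else 1 - t) * x w.1.
Proof.
suff /choice[j jE] : forall p : R * realization R K,
    exists y : realization R cylinder, p.1 \in `[0, 1] ->
      forall w, y w = (if w.2 then p.1 else 1 - p.1) * p.2 w.1.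
  by exists j => t x w t1; rewrite (jE (t, x)).
have slice (t : R) (x : realization R K) : t \in `[0, 1] -> exists y : realization R cylinder,
    forall w, y w = (if w.2 then t else 1 - t) * x w.1.
  rewrite in_itv /= => /andP[t0 t1].
  apply: (@exists_realization _ _ _ _ (fun w => (if w.2 then t else 1 - t) * x w.1)
    (prism_simplex (supp_simplex x))) => [w|w|].
  - by apply: mulr_ge0; [case: ifP; lra|exact: coord_ge0].
  - by rewrite mem_prism => /(coord_notin (fsubset_refl _)) ->; rewrite mulr0.
  - rewrite sum_prism /= -[RHS](coord_sum (fsubset_refl (finsupp x))).
    by apply: eq_bigr => v _; rewrite -mulrDl subrK mul1r.
move=> [t x]; have [/(slice _ x)[y yE]|/negP t1] := boolP (t \in `[0, 1]).
  by exists y.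
(* Outside the unit interval the slice at height 0 serves as a default value. *)
by have [|y _] := slice 0 x; [rewrite in_itv /= lexx ler01|exists y].
Qed.

End Cylinder.

(** * Existence and homotopy uniqueness of carried maps *)

Section Carriers.
Variables (R : realType) (V W : choiceType) (K : scomplex V) (L : scomplex W).

Definition acyclic_carrier (Phi : {fset V} -> scomplex W) : Prop :=
  [/\ forall F, simplices K F -> simplices (Phi F) `<=` simplices L,
      forall F, simplices K F -> contractible R (realization R (Phi F)) &
      forall F E, simplices K F -> (E `<=` F)%fset -> E != fset0 ->
        simplices (Phi E) `<=` simplices (Phi F)].

Definition carried (Phi : {fset V} -> scomplex W)
    (f : realization R K -> realization R L) : Prop :=
  forall x : realization R K, simplices (Phi (finsupp x)) (finsupp (f x)).

(** The construction [extend], fed with a contraction of each [Phi F]. The set [A] describes a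
    subcomplex on which the map is prescribed. *)
Lemma carrier_extension Phi (A : set {fset V}) (f0 : realization R K -> realization R L) :
  acyclic_carrier Phi ->
  (forall F E, A F -> (E `<=` F)%fset -> E != fset0 -> A E) ->
  (forall F, simplices K F -> A F -> {within closed_simplex F, continuous f0}) ->
  (forall x : realization R K, A (finsupp x) -> simplices (Phi (finsupp x)) (finsupp (f0 x))) ->
  exists f : realization R K -> realization R L,
    [/\ continuous f, carried Phi f & forall x : realization R K, A (finsupp x) -> f x = f0 x].
Proof.
move=> [PhiL Phic Phi_mono] A_face f0c f0Phi.
(* A point of |K| is wanted because [f0 x0] is the default in the choice of contractions; if |K| is
   empty, [f0] itself works. *)
have [x0|nK] := pselect (inhabited (realization R K)); last first.
  exists f0; split=> // [|x]; last by exfalso; apply: nK.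
  move=> x; exfalso; exact: nK.
case: x0 => x0.
have /choice[cH cHP] : forall F, exists cH : realization R L *
    (R * realization R L -> realization R L), simplices K F ->
  [/\ simplices (Phi F) (finsupp cH.1),
    {within `[0, 1] `*` [set y : realization R L | simplices (Phi F) (finsupp y)],
      continuous cH.2},
    forall t (y : realization R L), t \in `[0, 1] -> simplices (Phi F) (finsupp y) ->
      simplices (Phi F) (finsupp (cH.2 (t, y))),
    forall y : realization R L, simplices (Phi F) (finsupp y) -> cH.2 (0, y) = y &
    forall y : realization R L, simplices (Phi F) (finsupp y) -> cH.2 (1, y) = cH.1].
  move=> F; have [KF|nKF] := pselect (simplices K F); last first.
    by exists (f0 x0, (fun=> f0 x0)).
  by have [c [H cH]] := contractible_subcomplex (PhiL F KF) (Phic F KF); exists (c, H).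
exists (extend A f0 (fun F => (cH F).1) (fun F => (cH F).2)); split.
- apply: (extend_continuous (Phi := Phi)) => //.
  + by move=> F /cHP[].
  + by move=> F /cHP[].
  + by move=> F t y /cHP[_ _ + _ _]; exact.
  + by move=> F y /cHP[_ _ _ + _]; exact.
  + by move=> F y /cHP[_ _ _ _]; exact.
- move=> x; apply: extend_carried => //.
  + by move=> F /cHP[].
  + by move=> F t y /cHP[_ _ + _ _]; exact.
- by move=> x Ax; exact: extend_eq.
Qed.

(** With [A] empty nothing is prescribed, so any function can be extended; one exists because
    contractible spaces are nonempty. *)
Lemma carrier_existence Phi : acyclic_carrier Phi ->
  exists f : realization R K -> realization R L, continuous f /\ carried Phi f.
Proof.
move=> aPhi; have [PhiL Phic _] := aPhi.
have /choice[f0 _] : forall x : realization R K, exists y : realization R L, True.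
  move=> x; have Kx := supp_simplex x.
  by have [y _] := Phic _ Kx; exists (incl (PhiL _ Kx) y).
by have [//|//|//|f [cf Phif _]] := @carrier_extension Phi set0 f0 aPhi; exists f.
Qed.

End Carriers.

(** The maps [f] and [g], placed on the two ends of the cylinder, extend over it along the carrier
    [Phi \o shadow]; composing with the slices [j] gives the homotopy. *)
Lemma carrier_homotopic (R : realType) (V W : choiceType) (K : scomplex V)
    (L : scomplex W) (Phi : {fset V} -> scomplex W)
    (f g : realization R K -> realization R L) :
  acyclic_carrier R K L Phi -> continuous f -> continuous g ->
  carried Phi f -> carried Phi g -> homotopic R f g.
Proof.
move=> [PhiL Phic Phi_mono] cf cg fPhi gPhi.
have [p pE] := cylinder_projection K R; have [j jE] := cylinder_slice K R.
have p_supp (y : realization R (cylinder K)) :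
    (finsupp (p y) `<=` shadow (finsupp y))%fset.
  apply: closed_simplexP => v vy; rewrite pE.
  have yv b : y (v, b) = 0.
    apply: (coord_notin (fsubset_refl _)); apply: contra vy => vb.
    by apply/imfsetP; exists (v, b).
  by rewrite !yv addr0.
have cp : continuous p.
  apply: continuous_realization => E [nE KE].
  apply: (within_continuous_simplex KE).
    by move=> y yE; exact: fsubset_trans (p_supp y) (shadowS yE).
  move=> v _; apply: (@within_continuous_eq _ _ _
      (fun y : realization R (cylinder K) => y (v, false) + y (v, true))).
    by move=> y _; rewrite pE.
  apply: continuous_subspaceT => y.
  apply: (@cvgD _ _ _ (nbhs y) _ (fun y : realization R (cylinder K) => y (v, false) : R)
    (fun y : realization R (cylinder K) => y (v, true) : R)); exact: coord_continuous.
have cj F : simplices K F -> {within `[0, 1] `*` closed_simplex F, continuous j}.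
  move=> KF; apply: (within_continuous_simplex (prism_simplex KF)).
    move=> [t x] [/= It xF]; apply: closed_simplexP => w.
    by rewrite mem_prism jE // => /(coord_notin xF) ->; rewrite mulr0.
  move=> w _; apply: (@within_continuous_eq _ _ _
      (fun p : R * realization R K => (if w.2 then p.1 else 1 - p.1) * p.2 w.1)).
    by move=> [t x] [/= It xF]; rewrite jE.
  apply: continuous_subspaceT => q; apply: cvgM.
    by case: ifP => _; [|apply: cvgB; first exact: cvg_cst]; exact: cvg_fst.
  apply: (@continuous_comp _ _ _ snd (fun x : realization R K => x w.1 : R) q).
    exact: cvg_snd.
  exact: coord_continuous.
(* The simplices lying in one end. Continuity of [f0] is required only on these. *)
pose A : set {fset V * bool} := [set E | exists b, forall w, w \in E -> w.2 = b].
pose f0 (y : realization R (cylinder K)) :=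
  if `[< forall w, w \in finsupp y -> w.2 = true >] then g (p y) else f (p y).
have f0g (y : realization R (cylinder K)) :
    (forall w, w \in finsupp y -> w.2 = true) -> f0 y = g (p y).
  by move=> yt; rewrite /f0 asboolT.
have f0f (y : realization R (cylinder K)) :
    (forall w, w \in finsupp y -> w.2 = false) -> f0 y = f (p y).
  move=> yf; rewrite /f0 asboolF // => yt.
  have /fset0Pn[w wy] := simplex_neq0 (supp_simplex y).
  by have := yt w wy; rewrite yf.
have aPhi : acyclic_carrier R (cylinder K) L (Phi \o @shadow V).
  split=> [E [_ KE]|E [_ KE]|E E' [_ KE] E'E nE']; [exact: PhiL|exact: Phic|].
  by apply: Phi_mono => //; [exact: shadowS|exact: shadow_neq0].
have [|E JE [b Eb]|y _|k [ck _ kf0]] := @carrier_extension R _ _ (cylinder K) L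
    (Phi \o @shadow V) A f0 aPhi.
- by move=> F E [b Fb] /fsubsetP EF _; exists b => w /EF; exact: Fb.
- case: b Eb => Eb.
    apply: (@within_continuous_eq _ _ _ (g \o p)).
      by move=> y /fsubsetP yE; rewrite f0g // => w /yE /Eb.
    by apply: continuous_subspaceT => y; apply: continuous_comp; [exact: cp|exact: cg].
  apply: (@within_continuous_eq _ _ _ (f \o p)).
    by move=> y /fsubsetP yE; rewrite f0f // => w /yE /Eb.
  by apply: continuous_subspaceT => y; apply: continuous_comp; [exact: cp|exact: cf].
- have [_ Ky] := supp_simplex y; apply: Phi_mono (p_supp y) _ _ _ => //.
    exact: simplex_neq0 (supp_simplex (p y)).
  by rewrite /f0; case: ifP => _; [exact: gPhi|exact: fPhi].
(* A level of weight 0 does not meet the support, so [j] lands in an end at times 0 and 1. *)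
have j_supp (t : R) (x : realization R K) w : t \in `[0, 1] -> w \in finsupp (j (t, x)) ->
    (if w.2 then t else 1 - t) != 0.
  by move=> t1; rewrite mem_finsupp jE //; apply: contraNneq => ->; rewrite mul0r.
have pj (t : R) (x : realization R K) : t \in `[0, 1] -> p (j (t, x)) = x.
  move=> t1; apply: realization_ext => v.
  by rewrite pE !jE //= -mulrDl subrK mul1r.
have i0 : (0 : R) \in `[0, 1] by rewrite in_itv /= lexx ler01.
have i1 : (1 : R) \in `[0, 1] by rewrite in_itv /= lexx ler01.
exists (k \o j); split=> [|x|x] /=.
- apply: continuous_homotopy => F KF.
  apply: (within_continuous_comp (B := setT)) (cj F KF) _ => //.
  exact: continuous_subspaceT.
- have ws w : w \in finsupp (j (0, x)) -> w.2 = false.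
    by move/(j_supp _ _ _ i0); case: w.2; rewrite ?eqxx.
  by rewrite kf0 ?f0f ?pj //; exists false.
- have ws w : w \in finsupp (j (1, x)) -> w.2 = true.
    by move/(j_supp _ _ _ i1); case: w.2; rewrite ?subrr ?eqxx.
  by rewrite kf0 ?f0g ?pj //; exists true.
Qed.

(** * Barycentric subdivision as a complex *)

Section FaceComplex.
Variables (V : choiceType) (F : {fset V}).

Definition face_simplices : set {fset V} :=
  [set E | E != fset0 /\ (E `<=` F)%fset].

Lemma face_neq0 E : face_simplices E -> E != fset0. Proof. by case. Qed.

Lemma face_face (E E' : {fset V}) : face_simplices E ->
  (E' `<=` E)%fset -> E' != fset0 -> face_simplices E'.
Proof. by move=> [_ EF] E'E nE'; split=> //; exact: fsubset_trans EF. Qed.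

Definition face_complex : scomplex V := SComplex face_neq0 face_face.

Lemma face_contractible (R : realType) :
  F != fset0 -> contractible R (realization R face_complex).
Proof.
case/fset0Pn=> a aF; apply: (@cone_contractible _ _ _ a).
  by split; [apply/fset0Pn; exists a; rewrite inE|rewrite fsub1set].
by move=> E [nE EF]; split; [apply/fset0Pn; exists a; rewrite fset1U1|rewrite fsubUset fsub1set aF].
Qed.

End FaceComplex.

Lemma least_exists (T : eqType) (r : rel T) (s : seq T) :
  reflexive r -> transitive r -> s != [::] -> {in s &, total r} ->
  exists2 x, x \in s & {in s, forall y, r x y}.
Proof.
move=> rr rt; elim: s => // x [|y s] IH _ tot.
  by exists x; rewrite ?mem_head // => z; rewrite inE => /eqP ->.
have [||m ms mP] := IH.
- by [].
- by move=> u v us vs; apply: tot; rewrite in_cons ?us ?vs orbT.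
have mxs : m \in x :: y :: s by rewrite in_cons ms orbT.
have [xm|mx] := orP (tot x m (mem_head _ _) mxs).
  exists x; rewrite ?mem_head // => z; rewrite in_cons => /orP[/eqP -> //|/mP].
  exact: rt.
by exists m => // z; rewrite in_cons => /orP[/eqP -> //|/mP].
Qed.

Section Subdivision.
Variables (V : choiceType) (K : scomplex V).
Implicit Types c : {fset {fset V}}.

Definition sd_simplices : set {fset {fset V}} :=
  [set c | [/\ c != fset0, {in c, forall E, simplices K E} &
    {in c &, total (@fsubset V)}]].

Lemma sd_neq0 c : sd_simplices c -> c != fset0. Proof. by case. Qed.

Lemma sd_face c c' : sd_simplices c ->
  (c' `<=` c)%fset -> c' != fset0 -> sd_simplices c'.
Proof.
move=> [_ Kc totc] /fsubsetP c'c nc'; split=> // [E /c'c/Kc//|E E' /c'c Ec /c'c E'c].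
exact: totc.
Qed.

Definition subdivision : scomplex {fset V} := SComplex sd_neq0 sd_face.

End Subdivision.

Definition chain_min (V : choiceType) (c : {fset {fset V}}) : {fset V} :=
  xget fset0 [set E | E \in c /\ {in c, forall E', (E `<=` E')%fset}].

Definition chain_max (V : choiceType) (c : {fset {fset V}}) : {fset V} :=
  xget fset0 [set E | E \in c /\ {in c, forall E', (E' `<=` E)%fset}].

Section Chains.
Variables (V : choiceType) (K : scomplex V).
Implicit Types c : {fset {fset V}}.

Lemma chain_minP c : simplices (subdivision K) c ->
  chain_min c \in c /\ {in c, forall E, (chain_min c `<=` E)%fset}.
Proof.
case=> nc _ totc; rewrite /chain_min.
have [||||E Ec EP] := @least_exists _ (@fsubset V) c.
- by move=> E; exact: fsubset_refl.
- by move=> ? ? ?; exact: fsubset_trans.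
- by apply: contra nc => /eqP c0; apply/eqP/fsetP => E; rewrite inE -[E \in c]/(E \in (c : seq _)) c0.
- exact: totc.
by apply: (@xgetPex _ fset0 [set E | E \in c /\ {in c, forall E', (E `<=` E')%fset}]); exists E.
Qed.

Lemma chain_maxP c : simplices (subdivision K) c ->
  chain_max c \in c /\ {in c, forall E, (E `<=` chain_max c)%fset}.
Proof.
case=> nc _ totc; rewrite /chain_max.
have [||||E Ec EP] := @least_exists _ (fun E E' => @fsubset V E' E) c.
- by move=> E; exact: fsubset_refl.
- by move=> ? ? ? /[swap]; exact: fsubset_trans.
- by apply: contra nc => /eqP c0; apply/eqP/fsetP => E; rewrite inE -[E \in c]/(E \in (c : seq _)) c0.
- by move=> E E' Ec E'c; rewrite orbC; exact: totc.
by apply: (@xgetPex _ fset0 [set E | E \in c /\ {in c, forall E', (E' `<=` E)%fset}]); exists E.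
Qed.

Lemma chain_min_simplex c : simplices (subdivision K) c -> simplices K (chain_min c).
Proof. by move=> Kc; have [mc _] := chain_minP Kc; case: Kc => _ + _; exact. Qed.

Lemma chain_max_simplex c : simplices (subdivision K) c -> simplices K (chain_max c).
Proof. by move=> Kc; have [mc _] := chain_maxP Kc; case: Kc => _ + _; exact. Qed.

Lemma chain_minS c c' : simplices (subdivision K) c -> (c' `<=` c)%fset ->
  c' != fset0 -> (chain_min c `<=` chain_min c')%fset.
Proof.
move=> Kc c'c nc'; have [m'c' _] := chain_minP (simplex_face Kc c'c nc').
by have [_] := chain_minP Kc; apply; exact: (fsubsetP c'c).
Qed.

Lemma chain_maxS c c' : simplices (subdivision K) c -> (c' `<=` c)%fset ->
  c' != fset0 -> (chain_max c' `<=` chain_max c)%fset.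
Proof.
move=> Kc c'c nc'; have [m'c' _] := chain_maxP (simplex_face Kc c'c nc').
by have [_] := chain_maxP Kc; apply; exact: (fsubsetP c'c).
Qed.

End Chains.

Lemma subdivisionS (V : choiceType) (K L : scomplex V) :
  simplices K `<=` simplices L ->
  simplices (subdivision K) `<=` simplices (subdivision L).
Proof. by move=> KL c [nc Kc totc]; split=> // E /Kc/KL. Qed.

Lemma face_complexS (V : choiceType) (E F : {fset V}) : (E `<=` F)%fset ->
  simplices (face_complex E) `<=` simplices (face_complex F).
Proof. by move=> EF G [nG GE]; split=> //; exact: fsubset_trans EF. Qed.

Lemma face_complex_sub (V : choiceType) (K : scomplex V) (F : {fset V}) :
  simplices K F -> simplices (face_complex F) `<=` simplices K.
Proof. by move=> KF E [nE EF]; exact: simplex_face KF EF nE. Qed.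

(** The apex is [F] itself: it is comparable with each of its faces and can be added to any
    chain. *)
Lemma subdivision_face_contractible (R : realType) (V : choiceType) (F : {fset V}) :
  F != fset0 -> contractible R (realization R (subdivision (face_complex F))).
Proof.
move=> nF; apply: (@cone_contractible _ _ _ F).
  split.
  - by apply/fset0Pn; exists F; rewrite inE.
  - by move=> E; rewrite inE => /eqP ->; split=> //; exact: fsubset_refl.
  - by move=> E E'; rewrite !inE => /eqP -> /eqP ->; rewrite fsubset_refl.
move=> c [nc cF totc]; split.
- by apply/fset0Pn; exists F; rewrite fset1U1.
- move=> E; rewrite !inE => /orP[/eqP ->|/cF //].
  by split=> //; exact: fsubset_refl.
- move=> E E'; rewrite !inE => /orP[/eqP ->|Ec] /orP[/eqP ->|E'c].
  + by rewrite fsubset_refl.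
  + by have [_ ->] := cF _ E'c; rewrite orbT.
  + by have [_ ->] := cF _ Ec.
  + exact: totc.
Qed.

(** * Comparison of a complex with its subdivision *)

Section SubdivisionMaps.
Variables (R : realType) (V : choiceType) (K : scomplex V).

Lemma face_carrier : acyclic_carrier R K K (@face_complex V).
Proof.
split=> [F|F KF|F E _ EF _]; first exact: face_complex_sub.
- by apply: face_contractible; exact: simplex_neq0 KF.
- exact: face_complexS.
Qed.

Lemma subdivision_carrier :
  acyclic_carrier R K (subdivision K) (fun F => subdivision (face_complex F)).
Proof.
split=> [F KF|F KF|F E _ EF _].
- exact/subdivisionS/face_complex_sub.
- by apply: subdivision_face_contractible; exact: simplex_neq0 KF.
- exact/subdivisionS/face_complexS.
Qed.

Lemma chain_max_carrier :
  acyclic_carrier R (subdivision K) K (fun c => face_complex (chain_max c)).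
Proof.
split=> [c Kc|c Kc|c c' Kc c'c nc'].
- exact/face_complex_sub/chain_max_simplex.
- by apply: face_contractible; exact: simplex_neq0 (chain_max_simplex Kc).
- by apply: face_complexS; exact: chain_maxS Kc _ _.
Qed.

Lemma subdivision_chain_max_carrier : acyclic_carrier R (subdivision K) (subdivision K)
  (fun c => subdivision (face_complex (chain_max c))).
Proof.
split=> [c Kc|c Kc|c c' Kc c'c nc'].
- exact/subdivisionS/face_complex_sub/chain_max_simplex.
- by apply: subdivision_face_contractible; exact: simplex_neq0 (chain_max_simplex Kc).
- by apply/subdivisionS/face_complexS; exact: chain_maxS Kc _ _.
Qed.

Variable s : realization R K -> realization R (subdivision K).
Variable b : realization R (subdivision K) -> realization R K.
Hypothesis s_continuous : continuous s.
Hypothesis s_carried : carried (fun F => subdivision (face_complex F)) s.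
Hypothesis b_continuous : continuous b.
Hypothesis b_carried : carried (fun c => face_complex (chain_max c)) b.

(** Both maps keep every point in the closed simplex spanned by its support. *)
Lemma subdivisionK : homotopic R (b \o s) id.
Proof.
apply: (carrier_homotopic face_carrier).
- by move=> x; apply: continuous_comp; [exact: s_continuous|exact: b_continuous].
- by move=> x; exact: cvg_id.
- move=> x; have sx := s_carried x; apply: face_complexS (b_carried (s x)).
  by have [] := chain_max_simplex sx.
- by move=> x; split; [exact: simplex_neq0 (supp_simplex x)|exact: fsubset_refl].
Qed.

(** Both maps send a point with support [c] into the subdivision of the largest element of [c]. *)
Lemma subdivisionVK : homotopic R (s \o b) id.
Proof.
apply: (carrier_homotopic subdivision_chain_max_carrier).
- by move=> x; apply: continuous_comp; [exact: b_continuous|exact: s_continuous].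
- by move=> x; exact: cvg_id.
- move=> w; apply: subdivisionS (s_carried (b w)); apply: face_complexS.
  by have [] := b_carried w.
- move=> w; have Kw := supp_simplex w; have [nw Kc totw] := Kw; split=> // E Ew.
  by split; [exact: simplex_neq0 (Kc _ Ew)|have [_] := chain_maxP Kw; exact].
Qed.

End SubdivisionMaps.

(** * Carriers attached to a covering *)

Section NerveCarriers.
Variables (R : realType) (V : choiceType) (Y : scomplex V) (I : choiceType).
Variable Sigma : I -> scomplex V.
Hypothesis Sigma_sub : forall i, Sigma i `<=` Y.
Hypothesis Sigma_cover : \bigcup_i Sigma i = Y.
Hypothesis Sigma_inter : forall F : {fset I}, F != fset0 ->
  inter_complex Sigma F = set0 :> set {fset V} \/
  contractible R (realization R (inter_complex Sigma F)).

(** The nerve of the sets of simplices: two or more subcomplexes have a common point exactly when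
    they have a common simplex, namely the support of that point. *)
Let N := nerve Sigma.

Lemma inter_contractible (F : {fset I}) : simplices N F ->
  contractible R (realization R (inter_complex Sigma F)).
Proof.
move=> [nF [E EF]]; have [F0|//] := Sigma_inter nF.
have /fset0Pn[i iF] := nF.
have : simplices (inter_complex Sigma F) E.
  by split=> //; apply: (@simplex_neq0 _ (Sigma i)); exact: EF.
by rewrite F0.
Qed.

Lemma inter_sub (F : {fset I}) : F != fset0 -> simplices (inter_complex Sigma F) `<=` simplices Y.
Proof. by move=> /fset0Pn[i iF] E [_ SE]; exact: (Sigma_sub (SE i iF)). Qed.

Lemma interS (F F' : {fset I}) : (F `<=` F')%fset ->
  simplices (inter_complex Sigma F') `<=` simplices (inter_complex Sigma F).
Proof.
by move=> /fsubsetP FF' E [nE SE]; split=> // i iF; apply: SE; exact: FF'.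
Qed.

(** Two reversals cancel: enlarging the chain shrinks its least element, and fewer indices give a
    larger intersection. *)
Lemma chain_inter_carrier :
  acyclic_carrier R (subdivision N) Y (fun c => inter_complex Sigma (chain_min c)).
Proof.
split=> [c Nc|c Nc|c c' Nc c'c nc'].
- by apply: inter_sub; exact: simplex_neq0 (chain_min_simplex Nc).
- exact/inter_contractible/chain_min_simplex.
- by apply: interS; exact: chain_minS Nc _ _.
Qed.

Definition star_simplices (F : {fset I}) : set {fset I} :=
  [set E | E != fset0 /\ simplices N (E `|` F)%fset].

Lemma star_neq0 F E : star_simplices F E -> E != fset0. Proof. by case. Qed.

Lemma star_face F (E E' : {fset I}) : star_simplices F E ->
  (E' `<=` E)%fset -> E' != fset0 -> star_simplices F E'.
Proof.
move=> [_ NE] E'E nE'; split=> //; apply: simplex_face NE (fsetSU _ E'E) _.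
by rewrite fsetU_eq0 negb_and nE'.
Qed.

Definition star F : scomplex I := SComplex (@star_neq0 F) (@star_face F).

(** Any vertex of [F] is an apex of its closed star. *)
Lemma star_contractible F : simplices N F -> contractible R (realization R (star F)).
Proof.
move=> NF; have /fset0Pn[i iF] := simplex_neq0 NF.
apply: (@cone_contractible _ _ _ i).
  split; first by apply/fset0Pn; exists i; rewrite inE.
  by rewrite (fsetUidPr _ _ _) // fsub1set.
move=> E [nE NE]; split; first by apply/fset0Pn; exists i; rewrite fset1U1.
by rewrite -fsetUA (fsetUidPr [fset i]%fset _ _) // fsub1set inE iF orbT.
Qed.

Lemma chain_star_carrier :
  acyclic_carrier R (subdivision N) N (fun c => star (chain_min c)).
Proof.
split=> [c Nc E [nE NE]|c Nc|c c' Nc c'c nc' E [nE NE]].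
- exact: simplex_face NE (fsubsetUl _ _) nE.
- exact/star_contractible/chain_min_simplex.
- split=> //; apply: simplex_face NE (fsetUS _ (chain_minS Nc c'c nc')) _.
  by rewrite fsetU_eq0 negb_and nE.
Qed.

(** Allowing [S] to be any face of [F] makes the carrier monotone: [F] itself lies in fewer members
    of the covering as it grows. *)
Definition nerve_of_faces_simplices (F : {fset V}) : set {fset I} :=
  [set E | E != fset0 /\ exists2 S, simplices (face_complex F) S &
    forall i, i \in E -> simplices (Sigma i) S].

Lemma nerve_of_faces_neq0 F E : nerve_of_faces_simplices F E -> E != fset0.
Proof. by case. Qed.

Lemma nerve_of_faces_face F (E E' : {fset I}) : nerve_of_faces_simplices F E ->
  (E' `<=` E)%fset -> E' != fset0 -> nerve_of_faces_simplices F E'.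
Proof.
move=> [_ [S FS ES]] /fsubsetP E'E nE'; split=> //; exists S => // i /E'E.
exact: ES.
Qed.

Definition nerve_of_faces F : scomplex I :=
  SComplex (@nerve_of_faces_neq0 F) (@nerve_of_faces_face F).

Lemma cover_simplex F : simplices Y F -> exists i, simplices (Sigma i) F.
Proof. by rewrite -Sigma_cover => -[i _ iF]; exists i. Qed.

(* Any [i] with [F] in [Sigma i] is an apex: all faces of [F] are in [Sigma i]. *)
Lemma nerve_of_faces_contractible F : simplices Y F ->
  contractible R (realization R (nerve_of_faces F)).
Proof.
move=> YF; have [i iF] := cover_simplex YF.
apply: (@cone_contractible _ _ _ i).
  split; first by apply/fset0Pn; exists i; rewrite inE.
  exists F; first by split; [exact: simplex_neq0 YF|exact: fsubset_refl].
  by move=> j; rewrite inE => /eqP ->.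
move=> E [nE [S [nS SF] ES]]; split; first by apply/fset0Pn; exists i; rewrite fset1U1.
exists S; first by [].
move=> j; rewrite !inE => /orP[/eqP ->|/ES //]; exact: simplex_face iF SF nS.
Qed.

Lemma nerve_of_faces_sub F : simplices (nerve_of_faces F) `<=` simplices N.
Proof. by move=> E [nE [S _ ES]]; split=> //; exists S. Qed.

Lemma nerve_of_facesS F F' : (F `<=` F')%fset ->
  simplices (nerve_of_faces F) `<=` simplices (nerve_of_faces F').
Proof.
move=> FF' E [nE [S FS ES]]; split=> //; exists S => //.
exact: face_complexS FF' _ FS.
Qed.

Lemma nerve_of_faces_carrier : acyclic_carrier R Y N nerve_of_faces.
Proof.
split=> [F _|F|F E _ EF _]; first exact: nerve_of_faces_sub.
- exact: nerve_of_faces_contractible.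
- exact: nerve_of_facesS.
Qed.

Variables (f : realization R Y -> realization R N).
Hypothesis f_continuous : continuous f.
Hypothesis f_carried : carried nerve_of_faces f.
Variables (s : realization R N -> realization R (subdivision N)).
Hypothesis s_continuous : continuous s.
Hypothesis s_carried : carried (fun F => subdivision (face_complex F)) s.
Variables (h : realization R (subdivision N) -> realization R Y).
Hypothesis h_continuous : continuous h.
Hypothesis h_carried : carried (fun c => inter_complex Sigma (chain_min c)) h.

(* [f \o h] and the last-vertex map [b] are both carried by the closed star of
   the smallest element of a chain of simplices of the nerve. *)
Lemma nerve_section : homotopic R (f \o (h \o s)) id.
Proof.
have [b [cb bP]] := carrier_existence (@chain_max_carrier R I N).
apply: homotopic_trans (subdivisionK s_continuous s_carried cb bP).
apply: (@homotopic_compr _ _ _ _ (f \o h) b s) => //.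
apply: (carrier_homotopic chain_star_carrier) => //.
- by move=> x; apply: continuous_comp; [exact: h_continuous|exact: f_continuous].
(* The face [S] of the support of [h w] is common to the new indices [E], and it also lies in each
   [Sigma i] with [i] in the least element, as the whole support does. *)
- move=> w; have [nE [S [nS SF] ES]] := f_carried (h w).
  have [_ hw] := h_carried w.
  split=> //; split; first by rewrite fsetU_eq0 negb_and nE.
  exists S => i /=; rewrite inE => /orP[/ES //|/hw iw].
  exact: simplex_face iw SF nS.
(* The support of [b w] and the least element are both faces of the largest element of the chain, a
   simplex of the nerve. *)
- move=> w; have [nb bw] := bP w; split=> //.
  have Nw := supp_simplex w; apply: simplex_face (chain_max_simplex Nw) _ _.
    by rewrite fsubUset bw; have [_ ->] := chain_maxP Nw; have [] := chain_minP Nw.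
  by rewrite fsetU_eq0 negb_and nb.
Qed.

(** * The composite on [Y] through its second subdivision *)

Section Choice.
Variable iota : {fset V} -> I.
Hypothesis iotaP : forall F, simplices Y F -> simplices (Sigma (iota F)) F.

(* If [S] is a chain of chains of simplices of [Y] with smallest element [c],
   then every [Sigma i] with [i] in [J c] contains the smallest element of [c];
   this is what makes [h \o j] and [r] below lie in a common carrier. *)
Let J (c : {fset {fset V}}) : {fset I} := [fset iota E | E in c]%fset.

Lemma index_image_nerve c : simplices (subdivision Y) c -> simplices N (J c).
Proof.
move=> Yc; have [mc mP] := chain_minP Yc; have [nc Kc _] := Yc; split.
  by apply/fset0Pn; exists (iota (chain_min c)); apply/imfsetP; exists (chain_min c).
exists (chain_min c) => _ /imfsetP[E /= Ec ->].
apply: simplex_face (iotaP (Kc _ Ec)) (mP _ Ec) _.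
exact: simplex_neq0 (chain_min_simplex Yc).
Qed.

Lemma index_imageS c c' : (c `<=` c')%fset -> (J c `<=` J c')%fset.
Proof.
move=> /fsubsetP cc'; apply/fsubsetP => _ /imfsetP[E /= /cc' Ec ->].
by apply/imfsetP; exists E.
Qed.

Let JJ (S : {fset {fset {fset V}}}) : {fset {fset I}} := [fset J c | c in S]%fset.

Lemma index_image2_chain S : simplices (subdivision (subdivision Y)) S ->
  simplices (subdivision N) (JJ S).
Proof.
move=> [/fset0Pn[c cS] YS totS]; split.
- by apply/fset0Pn; exists (J c); apply/imfsetP; exists c.
- by move=> _ /imfsetP[c' /= c'S ->]; exact/index_image_nerve/YS.
- move=> _ _ /imfsetP[a /= aS ->] /imfsetP[d /= dS ->].
  by have /orP[/index_imageS ->|/index_imageS ->] := totS _ _ aS dS; rewrite ?orbT.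
Qed.

(** A map so carried stands in for the simplicial map sending a vertex [c] to [J c]. *)
Lemma index_carrier : acyclic_carrier R (subdivision (subdivision Y)) (subdivision N)
  (fun S => face_complex (JJ S)).
Proof.
split=> [S YS|S YS|S S' YS /fsubsetP S'S _].
- exact/face_complex_sub/index_image2_chain.
- by apply: face_contractible; exact: simplex_neq0 (index_image2_chain YS).
- apply: face_complexS; apply/fsubsetP => _ /imfsetP[c /= /S'S cS ->].
  by apply/imfsetP; exists c.
Qed.

(** Enlarging [S] shrinks [chain_min S], hence its image under [J], and so enlarges the
    intersection. *)
Lemma index_inter_carrier : acyclic_carrier R (subdivision (subdivision Y)) Y
  (fun S => inter_complex Sigma (J (chain_min S))).
Proof.
split=> [S YS|S YS|S S' YS S'S nS'].
- by apply: inter_sub; exact: simplex_neq0 (index_image_nerve (chain_min_simplex YS)).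
- exact/inter_contractible/index_image_nerve/chain_min_simplex.
- by apply/interS/index_imageS; exact: chain_minS YS _ _.
Qed.

(** Enlarging [S] shrinks the chain [chain_min S], whose own least element then grows. A single
    minimum would vary the wrong way, whence the second subdivision. *)
Lemma min_min_carrier : acyclic_carrier R (subdivision (subdivision Y)) Y
  (fun S => face_complex (chain_min (chain_min S))).
Proof.
split=> [S YS|S YS|S S' YS S'S nS'].
- exact/face_complex_sub/chain_min_simplex/chain_min_simplex.
- apply: face_contractible.
  exact: simplex_neq0 (chain_min_simplex (chain_min_simplex YS)).
- have YS' := simplex_face YS S'S nS'; have YmS := chain_min_simplex YS.
  have YmS' := chain_min_simplex YS'.
  apply: face_complexS; apply: chain_minS YmS' (chain_minS YS S'S nS') _.
  exact: simplex_neq0 YmS.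
Qed.

(** The homotopies run from [h s f] to [h s b j s2 s1], then to [h j s2 s1] since [s b] is homotopic
    to the identity, then to [r s2 s1], then to the identity. *)
Lemma nerve_retraction_index : homotopic R ((h \o s) \o f) id.
Proof.
have [b [cb bP]] := carrier_existence (@chain_max_carrier R I N).
have [s1 [cs1 s1P]] := carrier_existence (@subdivision_carrier R V Y).
have [s2 [cs2 s2P]] := carrier_existence (@subdivision_carrier R _ (subdivision Y)).
have [j [cj jP]] := carrier_existence index_carrier.
have [r [cr rP]] := carrier_existence min_min_carrier.
have s12P (x : realization R Y) : simplices (subdivision (subdivision (face_complex (finsupp x))))
    (finsupp (s2 (s1 x))).
  exact: subdivisionS (face_complex_sub (s1P x)) _ (s2P (s1 x)).
have cont_comp (A B C : topologicalType) (k : A -> B) (l : B -> C) :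
    continuous k -> continuous l -> continuous (l \o k).
  by move=> ck cl x; apply: continuous_comp; [exact: ck|exact: cl].
have cs12 : continuous (s2 \o s1) by exact: cont_comp.
have cjs : continuous (j \o (s2 \o s1)) by exact: cont_comp.
have f_index : homotopic R f (b \o (j \o (s2 \o s1))).
  apply: (carrier_homotopic nerve_of_faces_carrier) => //; first exact: cont_comp.
  (* The largest element of the support of [w] is [J c] for some chain [c] of faces of the support
     of [x]; the least element of [c] is the common face required by [nerve_of_faces]. *)
  move=> x; set w := j (s2 (s1 x)).
  have Sw := supp_simplex w; have [nE bE] := bP w.
  have [mw _] := chain_maxP Sw; have [_ /fsubsetP jw] := jP (s2 (s1 x)).
  have /imfsetP[c /= cS mc] := jw _ mw.
  have [_ s12 _] := s12P x; have {}s12 := s12 c cS.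
  have Yc : simplices (subdivision Y) c.
    exact: subdivisionS (face_complex_sub (supp_simplex x)) _ s12.
  split=> //; exists (chain_min c); first exact: chain_min_simplex s12.
  move=> i /(fsubsetP bE); rewrite mc => /imfsetP[E /= Ec ->].
  have [_ mP] := chain_minP Yc; have [_ Kc _] := Yc.
  apply: simplex_face (iotaP (Kc _ Ec)) (mP _ Ec) _.
  exact: simplex_neq0 (chain_min_simplex Yc).
have chs : continuous (h \o s) by exact: cont_comp.
apply: homotopic_trans (homotopic_compl chs f_index) _.
apply: (@homotopic_trans _ _ _ _ ((h \o j) \o (s2 \o s1))).
  apply: (@homotopic_compr _ _ _ _ ((h \o s) \o b) h (j \o (s2 \o s1)) cjs).
  exact: (@homotopic_compl _ _ _ _ (s \o b) id h h_continuous
    (subdivisionVK s_continuous s_carried cb bP)).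
apply: (@homotopic_trans _ _ _ _ (r \o (s2 \o s1))).
  apply: homotopic_compr => //.
  apply: (carrier_homotopic index_inter_carrier) => //; first exact: cont_comp.
  - move=> w; have Sw := supp_simplex w.
    apply: interS (h_carried (j w)).
    (* The least element of the support of [j w] is [J c] for some [c] in the support of [w], so it
       contains [J] of the least such chain. *)
    have [mj _] := chain_minP (supp_simplex (j w)).
    have [_ /fsubsetP jw] := jP w; have /imfsetP[c /= cw ->] := jw _ mj.
    by apply: index_imageS; have [_] := chain_minP Sw; exact.
  (* The support of [r w] is a face of the least element of [chain_min S], hence of every [E] in
     that chain, hence it lies in each [Sigma (iota E)]. *)
  - move=> w; have Sw := supp_simplex w; have Yc := chain_min_simplex Sw.
    have [nE Ec] := rP w; split=> // _ /imfsetP[E /= EcS ->].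
    have [_ mP] := chain_minP Yc; have [_ Kc _] := Yc.
    exact: simplex_face (iotaP (Kc _ EcS)) (fsubset_trans Ec (mP _ EcS)) nE.
apply: (carrier_homotopic (@face_carrier R V Y)) => //.
- exact: cont_comp.
- by move=> x; exact: cvg_id.
- move=> x; apply: face_complexS (rP (s2 (s1 x))).
  by have [] := chain_min_simplex (chain_min_simplex (s12P x)).
- by move=> x; split; [exact: simplex_neq0 (supp_simplex x)|exact: fsubset_refl].
Qed.

End Choice.

Lemma nerve_retraction : homotopic R ((h \o s) \o f) id.
Proof.
(* A point of |Y| yields an index to use as the value of [iota] off the simplices of [Y]; without
   points there is nothing to deform. *)
have [[x]|nY] := pselect (inhabited (realization R Y)).
  have [i _] := cover_simplex (supp_simplex x).
  have /choice[iota iotaP] : forall F, exists i, simplices Y F -> simplices (Sigma i) F.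
    move=> F; have [/cover_simplex[k kF]|nF] := pselect (simplices Y F).
      by exists k.
    by exists i.
  exact: nerve_retraction_index iotaP.
exists snd; split=> [p|x|x] //; exfalso; apply: nY; first by case: p.
by constructor.
Qed.

End NerveCarriers.

Theorem theorem2p8 (R : realType) (V : choiceType) (Y : scomplex V)
    (G : groupType) (aY : simplicial_action G Y)
    (I : choiceType) (aI : left_action G I)
    (Sigma : I -> scomplex V)
    (Sigma_sub : forall i, Sigma i `<=` Y)
    (Sigma_cover : \bigcup_i Sigma i = Y)
    (Sigma_act : forall g i, fset_action aY g @` Sigma i = Sigma (aI g i))
    (Sigma_inter : forall F : {fset I}, F != fset0 ->
       inter_complex Sigma F = set0 :> set {fset V} \/
       contractible R (realization R (inter_complex Sigma F))) :
  exists f : realization R Y -> realization R (nerve Sigma),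
    Gsim_homotopy_equivalence R (realization_action R aY)
      (realization_action R (nerve_action Sigma_act)) f.
Proof.
have [f [cf fP]] := carrier_existence (nerve_of_faces_carrier R Sigma_cover).
have [s [cs sP]] := carrier_existence (@subdivision_carrier R I (nerve Sigma)).
have [h [ch hP]] := carrier_existence (chain_inter_carrier Sigma_sub Sigma_inter).
exists f; split.
  split=> //; exists (h \o s); split.
  - by move=> x; apply: continuous_comp; [exact: cs|exact: ch].
  - exact: (nerve_retraction Sigma_sub Sigma_cover Sigma_inter).
  - exact: nerve_section.
move=> g.
have [faces_sub faces_contr _] := nerve_of_faces_carrier R Sigma_cover.
have actS (E F : {fset V}) : (E `<=` F)%fset -> (fset_act aY g E `<=` fset_act aY g F)%fset.
  by move=> /fsubsetP EF; apply/fsubsetP => v; rewrite !mem_fset_act; exact: EF.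
have act_neq0 (E : {fset V}) : E != fset0 -> fset_act aY g E != fset0.
  by case/fset0Pn=> v vE; apply/fset0Pn; exists (aY g v); apply/imfsetP; exists v.
(* For fixed [g] this is the carrier of [f] evaluated at the translate of [F], again a simplex of
   [Y]. Both composites of [f] with [g] are carried by it. *)
have carrier_g : acyclic_carrier R Y (nerve Sigma)
    (fun F => nerve_of_faces Sigma (fset_act aY g F)).
  split=> [F _|F YF|F E _ EF _]; first exact: nerve_of_faces_sub.
  - by apply: faces_contr; exact: simplex_act.
  - by apply: nerve_of_facesS; exact: actS.
apply: (carrier_homotopic carrier_g).
- by move=> x; apply: continuous_comp; [exact: cf|exact: top_act_continuous].
- by move=> x; apply: continuous_comp; [exact: top_act_continuous|exact: cf].
(* If [S] is a face shared by the [Sigma k] with [k] in the support of [f x], its translate is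
   shared by the [Sigma (aI g k)], by [Sigma_act]. *)
- move=> x; have [nE [S [nS SF] ES]] := fP x.
  split; first exact: simplex_neq0 (supp_simplex _).
  exists (fset_act aY g S); first by split; [exact: act_neq0|exact: actS].
  move=> i; rewrite /= finsupp_push => /imfsetP[k /= kE ->].
  by rewrite -Sigma_act; exists S => //; exact: ES.
- by move=> x; have := fP (realization_action R aY g x); rewrite /= finsupp_push.
Qed.
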